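(* Let $a,b,c\in\mathbb{R}\setminus\{0\}$ and let $W$ be the $3\times 3$ weight matrix on $\mathbb{R}$ $$W(x) = e^{-x^{2}}\begin{pmatrix} e^{2bx} + a^{2}x^{2} & ax & acx^{2} \\ ax & 1 & cx \\ acx^{2} & cx & c^{2}x^{2} + 1 \end{pmatrix}.$$ Let $D_1, D_2\in\mathcal{D}(W)$ be the differential operators $$D_{1} = \partial^{2}I + \partial \begin{pmatrix} 2b-2x & -2abx+2a & 0 \\ 0 & -2x & 0 \\ 0 & 2c & -2x \end{pmatrix} + \begin{pmatrix} 0 & 0 & 0 \\ 0 & 2 & 0 \\ 0 & 0 & 0 \end{pmatrix},$$ $$D_{2} = \partial^{2} \begin{pmatrix} 0 & ax & 0 \\ 0 & 1 & 0 \\ 0 & cx & 0 \end{pmatrix} + \partial \begin{pmatrix} 0 & 2a & -\frac{2ax}{c} \\ 0 & 0 & -\frac{2}{c} \\ 0 & 2c+\frac{2}{c} & -2x \end{pmatrix} + \begin{pmatrix} 2+\frac{4}{c^{2}} & 0 & -\frac{2a}{c} \\ 0 & 2+\frac{4}{c^{2}} & 0 \\ 0 & 0 & 0 \end{pmatrix}.$$ Then the algebra $\mathcal{D}(W)$ is generated as a $\mathbb{C}[D_{1}]$-module by $\{I, D_2\}$.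
   Context: Differential operators: $\operatorname{Mat}_N(\Omega[x])$ denotes the algebra of differential operators $D=\sum_{j=0}^m \partial^j F_j(x)$ with $\partial=\frac{d}{dx}$ and $F_j\in \operatorname{Mat}_N(\mathbb{C}[x])$. They act on the right of matrix-valued functions: $P\cdot D=\sum_{j=0}^m \partial^j(P)(x)F_j(x)$. Products are taken so that $P\cdot(DE)=(P\cdot D)\cdot E$. Orthogonal polynomials: for an $N\times N$ weight matrix $W$ supported on $(x_0,x_1)$ put $\langle P,Q\rangle_W=\int_{x_0}^{x_1}P(x)W(x)Q(x)^*\,dx$ for $P,Q\in\operatorname{Mat}_N(\mathbb{C}[x])$. A sequence of orthogonal polynomials for $W$ is a sequence $\{Q_n\}_{n\ge 0}$ in $\operatorname{Mat}_N(\mathbb{C}[x])$ such that $Q_n$ has degree $n$ with nonsingular leading coefficient and $\langle Q_n,Q_m\rangle_W=0$ for $n\neq m$. The algebra $\mathcal{D}(W)$: $$\mathcal{D}(W)=\{D\in\operatorname{Mat}_N(\Omega[x]) : \text{for every } n\ge 0 \text{ there is } \Gamma_n\in\operatorname{Mat}_N(\mathbb{C}) \text{ with } Q_n\cdot D=\Gamma_nQ_n\},$$ where $\{Q_n\}$ is any sequence of orthogonal polynomials for $W$ (the definition does not depend on the choice). Here $N=3$ and the support is $\mathbb{R}$. $\mathbb{C}[D_1]$ is the subalgebra of polynomials in $D_1$ with complex coefficients. *)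

(* Defs.v *)
From HB Require Import structures.
From mathcomp Require Import all_boot all_order all_algebra.
From mathcomp Require Import complex.
From mathcomp Require Import all_classical all_reals all_analysis.

Set Implicit Arguments.
Unset Strict Implicit.
Unset Printing Implicit Defensive.

Import Order.TTheory GRing.Theory Num.Theory.
Import numFieldNormedType.Exports.

Local Open Scope ring_scope.
Local Open Scope complex_scope.
Local Open Scope classical_set_scope.
Local Open Scope sesquilinear_scope.

Section DiffOp.
Variables (K : numFieldType) (n : nat).

Local Notation MP := 'M[{poly K}]_n.+1.

(* Only [MP] with [n.+1] is a nontrivial ring, hence the shift: [diffop K n]
   is Mat_(n+1)(Omega[x]).  An operator is its coefficient sequence,
   D = \sum_j d^j D`_j.  The product of this type is [dmul] below; it is not
   the product of {poly MP}. *)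
Definition diffop : Type := {poly MP}.

Definition mkdiffop (s : seq MP) : diffop := Poly s.

Definition mxderivn (j : nat) (P : MP) : MP := map_mx (derivn j) P.

Definition dact (P : MP) (D : {poly MP}) : MP :=
  \sum_(j < size D) mxderivn j P *m D`_j.

(* D d = \sum_j (d^(j+1) D`_j + d^j (D`_j)'), so that P . (D d) = (P . D)'. *)
Definition dder (D : {poly MP}) : {poly MP} :=
  D * 'X + map_poly (mxderivn 1) D.

(* D E = \sum_j (D d^j) E`_j *)
Definition dmul (D E : {poly MP}) : {poly MP} :=
  \sum_(j < size E) iter j dder D * (E`_j)%:P.

Definition dscale (z : K) (D : {poly MP}) : {poly MP} := (z%:P%:M : MP) *: D.

Fact mxderivnD j : {morph mxderivn j : P Q / P + Q}.
Proof. by move=> P Q; apply/matrixP=> i k; rewrite !mxE derivnD. Qed.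

Fact mxderivn0 j : mxderivn j 0 = 0.
Proof. by apply/matrixP=> i k; rewrite !mxE linear0. Qed.

Fact mxderivn_scalar j (p : {poly K}) : mxderivn j p%:M = (p^`(j))%:M.
Proof. by apply/matrixP=> i k; rewrite !mxE derivnMn. Qed.

Fact mxderivn_sum j I (r : seq I) (F : I -> MP) :
  mxderivn j (\sum_(i <- r) F i) = \sum_(i <- r) mxderivn j (F i).
Proof. exact: (big_morph _ (mxderivnD j) (mxderivn0 j)). Qed.

Fact mxderivnZ j (z : K) (P : MP) :
  mxderivn j (z%:P *: P) = z%:P *: mxderivn j P.
Proof. by apply/matrixP=> i k; rewrite !mxE !mul_polyC derivnZ. Qed.

Fact mxderivnS j (P : MP) : mxderivn 1 (mxderivn j P) = mxderivn j.+1 P.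
Proof. by apply/matrixP=> i k; rewrite !mxE derivn1 -derivnS. Qed.

Fact mxderiv1M (P Q : MP) :
  mxderivn 1 (P *m Q) = mxderivn 1 P *m Q + P *m mxderivn 1 Q.
Proof.
apply/matrixP=> i k; rewrite !mxE derivn1 linear_sum /= -big_split /=.
by apply: eq_bigr => l _; rewrite !mxE !derivn1 derivM.
Qed.

Fact dactE m (P : MP) (D : {poly MP}) : (size D <= m)%N ->
  dact P D = \sum_(j < m) mxderivn j P *m D`_j.
Proof.
move=> sDm; rewrite /dact (big_ord_widen m (fun j => mxderivn j P *m D`_j)) //.
rewrite big_mkcond /=; apply: eq_bigr => j _; case: ltnP => // sDj.
by rewrite nth_default // mulmx0.
Qed.

Fact dact0 P : dact P 0 = 0.
Proof. by rewrite /dact size_poly0 big_ord0. Qed.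

Fact dactD (P : MP) : {morph dact P : D E / D + E}.
Proof.
move=> D E; pose m := maxn (size D) (size E).
rewrite (@dactE m P (D + E)) ?size_polyD // (@dactE m P D) ?leq_maxl //.
rewrite (@dactE m P E) ?leq_maxr // -big_split /=.
by apply: eq_bigr => j _; rewrite coefD mulmxDr.
Qed.

Fact dactDl (D : {poly MP}) : {morph dact^~ D : P Q / P + Q}.
Proof.
move=> P Q; rewrite /= /dact -big_split /=.
by apply: eq_bigr => j _; rewrite mxderivnD mulmxDl.
Qed.

Fact dact_sum (P : MP) I (r : seq I) (F : I -> {poly MP}) :
  dact P (\sum_(i <- r) F i) = \sum_(i <- r) dact P (F i).
Proof. exact: (big_morph _ (dactD P) (dact0 P)). Qed.

Fact dact1 (P : MP) : dact P 1 = P.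
Proof.
rewrite /dact size_poly1 big_ord1 coef1 mulmx1.
by apply/matrixP=> i k; rewrite !mxE derivn0.
Qed.

Fact dactMC (P : MP) (D : {poly MP}) (F : MP) : dact P (D * F%:P) = dact P D *m F.
Proof.
rewrite (@dactE (size D) P (D * F%:P)); last first.
  by apply/leq_sizeP => j sDj; rewrite coefMC nth_default // mul0r.
by rewrite /dact mulmx_suml; apply: eq_bigr => j _; rewrite coefMC mulmxA.
Qed.

Fact dact_der (P : MP) (D : {poly MP}) : dact P (dder D) = mxderivn 1 (dact P D).
Proof.
have sd : (size (dder D) <= (size D).+1)%N.
  apply/leq_sizeP => j sDj; rewrite coefD coefMX coef_map_id0 ?mxderivn0 //.
  case: j sDj => // j sDj; rewrite !nth_default ?mxderivn0 ?addr0 //.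
  exact: ltnW.
rewrite (dactE P sd) (dactE P (leqnn _)) mxderivn_sum.
under eq_bigr do rewrite coefD coefMX coef_map_id0 ?mxderivn0 // mulmxDr.
rewrite big_split /= big_ord_recl /= mulmx0 add0r.
rewrite big_ord_recr /= nth_default // mxderivn0 mulmx0 addr0 -big_split /=.
by apply: eq_bigr => j _; rewrite mxderiv1M mxderivnS /bump /= add1n.
Qed.

Theorem dact_mul (P : MP) (D E : {poly MP}) :
  dact P (dmul D E) = dact (dact P D) E.
Proof.
rewrite /dmul dact_sum; apply: eq_bigr => j _; rewrite dactMC; congr (_ *m _).
elim: (val j) => [|k IHk] /=; last by rewrite dact_der IHk mxderivnS.
by apply/matrixP=> i l; rewrite !mxE derivn0.
Qed.

Theorem dact_inj (D E : {poly MP}) : (forall P, dact P D = dact P E) -> D = E.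
Proof.
move=> DE; apply/eqP; rewrite -subr_eq0; apply/eqP.
have {DE} act0 P : dact P (D - E) = 0.
  apply: (addIr (dact P E)); rewrite -dactD subrK add0r; exact: DE.
move: (D - E) act0 => {E}D act0; apply/polyP => m; rewrite coef0.
elim/ltn_ind: m => m IHm; have [sDm|mD] := leqP (size D) m.
  by rewrite nth_default.
have := act0 (('X^m)%:M); rewrite /dact (bigD1 (Ordinal mD)) //= big1 => [|j jm].
  rewrite addr0 mxderivn_scalar derivnXn subnn expr0 ffactnn.
  rewrite mul_scalar_mx => /matrixP DM; apply/matrixP => i k.
  have := DM i k; rewrite !mxE mulr_natl => /eqP.
  rewrite -mulr_natl mulf_eq0 -polyC_natr polyC_eq0 pnatr_eq0.
  by rewrite eqn0Ngt fact_gt0 /= => /eqP.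
have [jlt|mj] := ltnP j m; first by rewrite IHm // mulmx0.
have {}mj : (m < j)%N by rewrite ltn_neqAle mj andbT eq_sym.
by rewrite mxderivn_scalar derivnXn ffact_small // mulr0n raddf0 mul0mx.
Qed.

Fact dact_scale z (P : MP) (D : {poly MP}) :
  dact P (dscale z D) = z%:P *: dact P D.
Proof.
rewrite (@dactE (size D) P (dscale z D)); last first.
  by apply/leq_sizeP => j sDj; rewrite coefZ nth_default // mulr0.
rewrite scaler_sumr; apply: eq_bigr => j _.
by rewrite coefZ -[_%:M * _]/(_%:M *m _) mul_scalar_mx -scalemxAr.
Qed.

Fact dactZl z (P : MP) (D : {poly MP}) : dact (z%:P *: P) D = z%:P *: dact P D.
Proof.
by rewrite scaler_sumr; apply: eq_bigr => j _; rewrite mxderivnZ scalemxAl.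
Qed.

Fact dmulA : associative dmul.
Proof. by move=> D E F; apply: dact_inj => P; rewrite !dact_mul. Qed.

Fact dmul1r : left_id 1 dmul.
Proof. by move=> D; apply: dact_inj => P; rewrite dact_mul dact1. Qed.

Fact dmulr1 : right_id 1 dmul.
Proof. by move=> D; apply: dact_inj => P; rewrite dact_mul dact1. Qed.

Fact dmulDl : left_distributive dmul +%R.
Proof.
by move=> D E F; apply: dact_inj => P; rewrite !(dact_mul, dactD) dactDl.
Qed.

Fact dmulDr : right_distributive dmul +%R.
Proof. by move=> D E F; apply: dact_inj => P; rewrite !(dact_mul, dactD). Qed.

Fact dscaleA x y D : dscale x (dscale y D) = dscale (x * y) D.
Proof.
by apply: dact_inj => P; rewrite !dact_scale scalerA polyCM.
Qed.

Fact dscale1r : left_id 1 dscale.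
Proof. by move=> D; apply: dact_inj => P; rewrite dact_scale scale1r. Qed.

Fact dscaleDr : right_distributive dscale +%R.
Proof.
by move=> z D E; apply: dact_inj => P; rewrite !(dact_scale, dactD) scalerDr.
Qed.

Fact dscaleDl D : {morph dscale^~ D : x y / x + y}.
Proof.
move=> x y; apply: dact_inj => P.
by rewrite /= dactD !dact_scale polyCD scalerDl.
Qed.

Fact dscaleAl x D E : dscale x (dmul D E) = dmul (dscale x D) E.
Proof.
by apply: dact_inj => P; rewrite !(dact_mul, dact_scale) dactZl.
Qed.

Fact dscaleAr x D E : dscale x (dmul D E) = dmul D (dscale x E).
Proof. by apply: dact_inj => P; rewrite !(dact_mul, dact_scale). Qed.

HB.instance Definition _ := GRing.Zmodule.copy diffop {poly MP}.
HB.instance Definition _ := GRing.Zmodule_isNzRing.Build diffop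
  dmulA dmul1r dmulr1 dmulDl dmulDr (oner_neq0 {poly MP}).
HB.instance Definition _ := GRing.Zmodule_isLmodule.Build K diffop
  dscaleA dscale1r dscaleDr dscaleDl.
HB.instance Definition _ := GRing.Lmodule_isLalgebra.Build K diffop dscaleAl.
HB.instance Definition _ := GRing.Lalgebra_isAlgebra.Build K diffop dscaleAr.

End DiffOp.

Section OrthogonalPolynomials.
Variables (R : realType) (n : nat).
Local Notation C := R[i].
Local Notation N := n.+1.
Implicit Types (W : R -> 'M[C]_N) (P Q : 'M[{poly C}]_N).

Definition cintegral (f : R -> C) : C :=
  (\int[lebesgue_measure]_x complex.Re (f x))%R
  +i* (\int[lebesgue_measure]_x complex.Im (f x))%R.

Definition mxeval P (x : R) : 'M[C]_N :=
  map_mx (fun p : {poly C} => p.[x%:C]) P.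

Definition inner W P Q : 'M[C]_N :=
  \matrix_(i, j) cintegral (fun x => (mxeval P x *m W x *m (mxeval Q x)^t*) i j).

(* Since N > 0, the second condition forces the degree to be exactly k. *)
Definition mxdegree (k : nat) P : Prop :=
  (forall i j, (size (P i j) <= k.+1)%N) /\ map_mx (coefp k) P \in unitmx.

Definition orthogonal_seq W (S : nat -> 'M[{poly C}]_N) : Prop :=
  (forall k, mxdegree k (S k)) /\ (forall k l, k != l -> inner W (S k) (S l) = 0).

(* D(W), for weights supported on the whole real line.  If W has no sequence of
   orthogonal polynomials, this is all of [diffop C n]. *)
Definition algD W : set (diffop C n) :=
  [set D | forall S, orthogonal_seq W S ->
     forall k, exists G : 'M[C]_N, dact (S k) D = map_mx polyC G *m S k].

End OrthogonalPolynomials.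

Definition mx3 (T : pzRingType) (a00 a01 a02 a10 a11 a12 a20 a21 a22 : T) :
  'M[T]_3 :=
  \matrix_(i, j)
    (nth [::] [:: [:: a00; a01; a02]; [:: a10; a11; a12]; [:: a20; a21; a22]] i)`_j.

Section Example.
Variables (R : realType) (a b c : R).
Local Notation C := R[i].
Local Notation "x %:CP" := ((x%:C)%:P : {poly C}) (at level 1, format "x %:CP").

Definition W (x : R) : 'M[C]_3 :=
  map_mx (real_complex R)
    (expR (- x ^+ 2) *:
     mx3 (expR (2 * b * x) + a ^+ 2 * x ^+ 2) (a * x) (a * c * x ^+ 2)
         (a * x)                              1       (c * x)
         (a * c * x ^+ 2)                     (c * x) (c ^+ 2 * x ^+ 2 + 1)).

Definition D1 : diffop C 2 := mkdiffop
  [:: mx3 0 0 0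
          0 2 0
          0 0 0;
      mx3 ((2 * b)%:CP - 2 *: 'X) (- (2 * a * b)%:CP * 'X + (2 * a)%:CP) 0
          0                       (- (2 *: 'X))                          0
          0                       (2 * c)%:CP                 (- (2 *: 'X));
      1%:M].

Definition D2 : diffop C 2 := mkdiffop
  [:: mx3 (2 + 4 / c ^+ 2)%:CP 0                    (- (2 * a / c)%:CP)
          0                    (2 + 4 / c ^+ 2)%:CP 0
          0                    0                    0;
      mx3 0 (2 * a)%:CP         (- (2 * a / c)%:CP * 'X)
          0 0                   (- (2 / c)%:CP)
          0 (2 * c + 2 / c)%:CP (- (2 *: 'X));
      mx3 0 (a%:CP * 'X) 0
          0 1            0
          0 (c%:CP * 'X) 0].

End Example.

(* Main.v *)
Require Import Defs.
From mathcomp Require Import all_boot all_order all_algebra.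
From mathcomp Require Import complex.
From mathcomp Require Import all_classical all_reals all_analysis.
From mathcomp Require Import measurable_realfun.
From mathcomp Require Import ring lra zify.

(* Multiplication by T = straight turns the weight into diag(e^(-x^2 + 2 b x),
   e^(-x^2), e^(-x^2)), for which the n-th orthogonal polynomial has rows
   (K_n, a H_(n+1), 0), (0, c H_(n+1), H_n) and
   (- k a n K_(n-1) / 2, H_n, - c n H_(n-1) / 2), where H_n and K_n are the monic
   Hermite polynomials centred at 0 and at b and k is the ratio of the masses of
   the two Gaussians.  An operator belongs to D(W) exactly when it preserves the
   span of these three rows for every n, and D1 and D2 do so.

   Conversely, the substitution X^n |-> H_n maps differential operators to
   differential operators, and replaces H_n by X^n and K_n by (X - b)^n.  Since
   b <> 0, a nonzero operator cannot send every (X - b)^n to a polynomial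
   divisible by X^(n - r); this forces the entries that mix the first
   coordinate with the other two to vanish.  Comparing coefficients in the
   remaining entries, the eigenvalue matrices of an operator in D(W) are
   determined, for n > 1, by two polynomials in n, and every such pair is
   realized by p(D1) + q(D1) D2. *)

Set Implicit Arguments.
Unset Strict Implicit.
Unset Printing Implicit Defensive.

Import Order.TTheory GRing.Theory Num.Theory.

Local Open Scope ring_scope.

(** * Scalar differential operators *)

Section ScalarOperators.
Variable K : numFieldType.
Implicit Types (p q : {poly K}) (c d : {poly {poly K}}) (s t z : K).

(** Scalar counterpart of [dact]: the outer indeterminate of [c] stands for the derivation and the
    coefficients multiply after it. The ring product of [{poly {poly K}}] is not composition of
    operators. *)
Definition dop c p : {poly K} := \sum_(j < size c) derivn j p * c`_j.

Lemma dopE m c p : (size c <= m)%N -> dop c p = \sum_(j < m) derivn j p * c`_j.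
Proof.
move=> scm; rewrite /dop (big_ord_widen m (fun j => derivn j p * c`_j)) //.
rewrite big_mkcond /=; apply: eq_bigr => j _; case: ltnP => // scj.
by rewrite nth_default // mulr0.
Qed.

Lemma dop0 p : dop 0 p = 0.
Proof. by rewrite /dop size_poly0 big_ord0. Qed.

Lemma dopDl c d p : dop (c + d) p = dop c p + dop d p.
Proof.
pose m := maxn (size c) (size d).
rewrite (@dopE m (c + d)) ?size_polyD // (@dopE m c) ?leq_maxl //.
rewrite (@dopE m d) ?leq_maxr // -big_split /=.
by apply: eq_bigr => j _; rewrite coefD mulrDr.
Qed.

Lemma dopZ c z p : dop c (z *: p) = z *: dop c p.
Proof.
by rewrite /dop scaler_sumr; apply: eq_bigr => j _; rewrite derivnZ scalerAl.
Qed.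

Lemma dop0r c : dop c 0 = 0.
Proof. by have := dopZ c 0 0; rewrite !scale0r. Qed.

Lemma dopC q p : dop q%:P p = p * q.
Proof. by rewrite (@dopE 1) ?size_polyC_leq1 // big_ord1 coefC derivn0. Qed.

Lemma dopMX c p : dop (c * 'X) p = dop c (deriv p).
Proof.
rewrite (@dopE (size c).+1); last first.
  by apply: leq_trans (size_polyMleq _ _) _; rewrite size_polyX addn2.
rewrite big_ord_recl coefMX eqxx mulr0 add0r.
by apply: eq_bigr => j _; rewrite coefMX lift0 derivSn.
Qed.

Lemma dopMC c q p : dop (c * q%:P) p = dop c p * q.
Proof.
rewrite (@dopE (size c)); last first.
  by apply/leq_sizeP => j scj; rewrite coefMC nth_default // mul0r.
by rewrite mulr_suml; apply: eq_bigr => j _; rewrite coefMC mulrA.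
Qed.

Lemma dop_deriv c p : deriv (dop c p) = dop (c * 'X + map_poly (@deriv K) c) p.
Proof.
elim/poly_ind: c p => [|c q IH] p.
  by rewrite mul0r map_poly0 addr0 !dop0 deriv0.
have -> : map_poly (@deriv K) (c * 'X + q%:P) = map_poly (@deriv K) c * 'X + (deriv q)%:P.
  by rewrite raddfD /= map_polyC; congr (_ + _); apply/polyP => i;
     rewrite coefMX !coef_map_id0 ?deriv0 // coefMX; case: eqP; rewrite ?deriv0.
have := IH (deriv p).
rewrite !(dopDl, dopMX, dopC) derivD derivM => ->.
by ring.
Qed.

Lemma derivn_XsubC_exp j n t :
  derivn j (('X - t%:P) ^+ n) = (n ^_ j)%:R *: ('X - t%:P) ^+ (n - j).
Proof.
elim: j => [|j IH]; first by rewrite derivn0 ffactn0 scale1r subn0.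
rewrite derivnS IH derivZ ffactnSr natrM -scalerA subnS; congr (_ *: _).
case: (n - j)%N => [|k]; first by rewrite expr0 derivC scale0r.
by rewrite deriv_exp derivXsubC mul1r scaler_nat.
Qed.

Lemma dop_XsubC_exp c n t : dop c (('X - t%:P) ^+ n) =
  \sum_(j < size c) (n ^_ j)%:R *: (('X - t%:P) ^+ (n - j) * c`_j).
Proof. by apply: eq_bigr => j _; rewrite derivn_XsubC_exp scalerAl. Qed.

Lemma dop_exp_dvd c n t :
  ('X - t%:P) ^+ (n - size c) %| dop c (('X - t%:P) ^+ n).
Proof.
rewrite dop_XsubC_exp.
apply: (big_ind (fun q => _ %| q)) => [|p q|j _]; [exact: dvdp0|exact: dvdp_add|].
by rewrite -mul_polyC dvdp_mull // dvdp_mulr // dvdp_exp2l // leq_sub2l // ltnW.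
Qed.

(* Clearing denominators in [dop_XsubC_exp] removes the truncated subtraction
   and leaves coefficients that are polynomial in n. *)
Lemma dop_XsubC_expM c n t (Z := 'X - t%:P) :
  Z ^+ size c * dop c (Z ^+ n) =
  Z ^+ n * \sum_(j < size c) (n ^_ j)%:R *: (Z ^+ (size c - j) * c`_j).
Proof.
rewrite dop_XsubC_exp !mulr_sumr; apply: eq_bigr => j _.
have [lejn|ltnj] := leqP j n; last by rewrite ffact_small // !scale0r !mulr0.
rewrite -!scalerAr !mulrA -!exprD; congr (_ *: (_ ^+ _ * _)).
by have := ltn_ord j; lia.
Qed.

Definition ffpoly j : {poly K} := \prod_(i < j) ('X - i%:R%:P).

Lemma horner_ffpoly j n : (ffpoly j).[n%:R] = (n ^_ j)%:R.
Proof.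
elim: j => [|j IH]; first by rewrite /ffpoly big_ord0 hornerC.
rewrite /ffpoly big_ord_recr hornerM -/(ffpoly j) IH !hornerE ffactnSr natrM.
have [lejn|ltnj] := leqP j n; first by rewrite natrB.
by rewrite ffact_small // !mul0r.
Qed.

Lemma poly_eq0_nat p N : (forall n, (N <= n)%N -> p.[n%:R] = 0) -> p = 0.
Proof.
move=> p0; apply/eqP; apply: contraT => pN0.
pose s := [seq (N + i)%:R : K | i <- iota 0 (size p)].
have /(max_poly_roots pN0) : all (root p) s.
  by apply/allP => _ /mapP[i _ ->]; rewrite rootE p0 ?leq_addr.
rewrite size_map size_iota ltnn; apply.
rewrite map_inj_uniq ?iota_uniq // => i j /eqP.
by rewrite eqr_nat eqn_add2l => /eqP.
Qed.

(** The sum is the value at n of a polynomial, so vanishing for large n gives vanishing for all n.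
    At n = j the terms of index above j are zero, so the system is triangular with diagonal j!. *)
Lemma ffact_sum_eq0 (m N : nat) (u : nat -> K) :
  (forall n, (N <= n)%N -> \sum_(j < m) (n ^_ j)%:R * u j = 0) ->
  forall j, (j < m)%N -> u j = 0.
Proof.
move=> u0; have p0 n : \sum_(j < m) (n ^_ j)%:R * u j = 0.
  have pE k : (\sum_(j < m) u j *: ffpoly j).[k%:R] =
      \sum_(j < m) (k ^_ j)%:R * u j.
    rewrite horner_sum; apply: eq_bigr => j _.
    by rewrite hornerZ horner_ffpoly mulrC.
  rewrite -pE; set P := \sum_(j < m) _.
  by rewrite (_ : P = 0) ?horner0 //; apply: (@poly_eq0_nat _ N) => k /u0; rewrite pE.
elim/ltn_ind => j IH ltjm; have := p0 j.
rewrite (bigD1 (Ordinal ltjm)) //= big1; last first.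
  move=> i neqij.
  have [ltij|leji] := ltnP i j; first by rewrite IH ?mulr0.
  by rewrite ffact_small ?mul0r // ltn_neqAle leji andbT eq_sym.
rewrite addr0 ffactnn => /eqP.
by rewrite mulf_eq0 pnatr_eq0 -leqn0 leqNgt fact_gt0 /= => /eqP.
Qed.

(** After denominators are cleared, the power of X - s is coprime to [Z ^+ n] and must divide the
    cofactor [Q n]. The degree of [Q n] is bounded independently of n, so [Q n] vanishes for large
    n, and [ffact_sum_eq0] applies to each of its coefficients. *)
Lemma dop_eq0_of_dvd c s t N r : s != t ->
  (forall n, (N <= n)%N ->
     ('X - s%:P) ^+ (n - r) %| dop c (('X - t%:P) ^+ n)) -> c = 0.
Proof.
move=> neq_st dvd_c; pose Z := 'X - t%:P; pose J := size c.
pose Q n := \sum_(j < J) (n ^_ j)%:R *: (Z ^+ (J - j) * c`_j).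
pose B := (\max_(j < J) size (Z ^+ (J - j) * c`_j)%R)%N.
have sQ n : (size (Q n) <= B)%N.
  apply: leq_trans (size_sum _ _ _) _; apply/bigmax_leqP => j _.
  by apply: leq_trans (size_scale_leq _ _) _; apply: (leq_bigmax j).
have dvdQ n : (N <= n)%N -> ('X - s%:P) ^+ (n - r) %| Q n.
  move=> /dvd_c dvdn.
  have : ('X - s%:P) ^+ (n - r) %| Z ^+ n * Q n.
    by rewrite -dop_XsubC_expM dvdp_mull.
  rewrite Gauss_dvdpr // coprimep_expl // coprimep_expr //.
  by rewrite coprimep_XsubC2 // subr_eq0 eq_sym.
have Q0 n : (N + r + B <= n)%N -> Q n = 0.
  move=> len; apply/eqP; apply: contraT => Qn0.
  have leNn : (N <= n)%N by apply: leq_trans len; rewrite -addnA leq_addr.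
  have := leq_trans (dvdp_leq Qn0 (dvdQ n leNn)) (sQ n).
  by rewrite size_exp_XsubC; lia.
apply/polyP => j; rewrite coef0; have [?|ltjJ] := leqP J j.
  exact: nth_default.
suff /eqP : Z ^+ (J - j) * c`_j = 0.
  by rewrite mulf_eq0 expf_eq0 polyXsubC_eq0 andbF /= => /eqP.
apply/polyP => k; rewrite coef0.
apply: (@ffact_sum_eq0 J (N + r + B) (fun j => (Z ^+ (J - j) * c`_j)`_k)) => //.
move=> n /Q0 /(congr1 (fun q : {poly K} => q`_k)); rewrite coef0 coef_sum => Qn0.
by rewrite -[RHS]Qn0; apply: eq_bigr => i _; rewrite coefZ.
Qed.

Lemma dop_eq0_XsubC c t N :
  (forall n, (N <= n)%N -> dop c (('X - t%:P) ^+ n) = 0) -> c = 0.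
Proof.
(* Everything divides 0, so any point other than t serves; t + 1 is one. *)
move=> c0; apply: (@dop_eq0_of_dvd c (t + 1) t N 0) => [|n /c0 ->].
  by rewrite -subr_eq0 addrAC subrr add0r oner_eq0.
exact: dvdp0.
Qed.

(* Evaluating at t + 1 isolates the eigenvalue. *)
Lemma dop_diag_poly c t (A : nat -> K) N :
  (forall n, (N <= n)%N ->
     dop c (('X - t%:P) ^+ n) = A n *: ('X - t%:P) ^+ n) ->
  exists P : {poly K}, forall n, (N <= n)%N -> A n = P.[n%:R].
Proof.
move=> diag_c; exists (\sum_(j < size c) (c`_j).[t + 1] *: ffpoly j) => n /diag_c.
move=> /(congr1 (horner^~ (t + 1))).
have Z1 m : (('X - t%:P) ^+ m).[t + 1] = 1.
  by rewrite horner_exp hornerXsubC addrAC subrr add0r expr1n.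
rewrite hornerZ Z1 mulr1 => <-; rewrite dop_XsubC_exp !horner_sum.
apply: eq_bigr => j _; rewrite !hornerZ hornerM Z1 mul1r horner_ffpoly.
by rewrite mulrC.
Qed.

(** The eigenvalue is the coefficient of X^n on the left. The term of order 0 contributes nothing to
    it, and (n+1)^_(j+1) = (n+1) n^_j supplies the factor n+1. *)
Lemma dop_lower_poly c (A : nat -> K) N :
  (forall n, (N <= n)%N -> dop c 'X^(n.+1) = A n *: 'X^n) ->
  exists P : {poly K}, forall n, (N <= n)%N -> A n = n.+1%:R * P.[n%:R].
Proof.
move=> low_c; exists (\sum_(j < (size c).-1) (c`_j.+1)`_j *: ffpoly j) => n /low_c.
have X0 : 'X = 'X - (0 : K)%:P by rewrite subr0.
rewrite [X in dop _ (X ^+ _)]X0 dop_XsubC_exp -X0.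
move=> /(congr1 (fun p : {poly K} => p`_n)).
rewrite coefZ coefXn eqxx mulr1 => <-.
rewrite horner_sum coef_sum mulr_sumr; case: (size c) => [|J]; first by rewrite !big_ord0.
rewrite big_ord_recl /= subn0 coefZ coefXnM ltnS leqnn mulr0 add0r.
apply: eq_bigr => j _; rewrite /bump /= add1n subSS coefZ coefXnM hornerZ horner_ffpoly.
rewrite ffactSS natrM -mulrA; congr (_ * _); rewrite [RHS]mulrC.
have [lejn|ltnj] := leqP j n; last by rewrite ffact_small // !mul0r.
by rewrite ltnNge leq_subr /= subKn.
Qed.

End ScalarOperators.

(** * The Hermite transform *)

Section HermiteTransform.
Variable K : numFieldType.
Implicit Types (p q : {poly K}) (c : {poly {poly K}}) (t z : K).

(** This is -1/2 times the derivation conjugated by e^(-x^2); iterated on 1 it yields the monic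
    Hermite polynomials. *)
Definition herm_raise p : {poly K} := 'X * p - 2^-1 *: deriv p.

Definition herm n : {poly K} := iter n herm_raise 1.

Lemma coef_herm n : (size (herm n) <= n.+1)%N /\ (herm n)`_n = 1.
Proof.
elim: n => [|n [sH H1]]; first by rewrite /herm /= size_poly1 coef1.
have coefH k : (herm n.+1)`_k =
    (if k == 0%N then 0 else (herm n)`_k.-1) - 2^-1 * (herm n)`_k.+1 *+ k.+1.
  by rewrite /herm iterS /herm_raise coefB coefXM coefZ coef_deriv mulrnAr.
split; last by rewrite coefH /= H1 (nth_default _ (leq_trans sH _)) // mulr0 mul0rn subr0.
apply/leq_sizeP => k ltnk; rewrite coefH; case: k ltnk => // k ltnk.
rewrite /= (nth_default _ (leq_trans sH _)) // (nth_default _ (leq_trans sH _)).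
  by rewrite mulr0 mul0rn subr0.
by rewrite ltnW // ltnW.
Qed.

(* By [hermT_MXsubC], (X - t)^n is sent to the n-th monic Hermite polynomial
   centred at t. *)
Definition hermT p : {poly K} := \sum_(i < size p) p`_i *: herm i.

Lemma hermTE m p : (size p <= m)%N -> hermT p = \sum_(i < m) p`_i *: herm i.
Proof.
move=> spm; rewrite /hermT (big_ord_widen m (fun i => p`_i *: herm i)) //.
rewrite big_mkcond /=; apply: eq_bigr => i _; case: ltnP => // spi.
by rewrite nth_default // scale0r.
Qed.

Lemma hermTD p q : hermT (p + q) = hermT p + hermT q.
Proof.
pose m := maxn (size p) (size q).
rewrite (@hermTE m (p + q)) ?size_polyD // (@hermTE m p) ?leq_maxl //.
rewrite (@hermTE m q) ?leq_maxr // -big_split /=.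
by apply: eq_bigr => i _; rewrite coefD scalerDl.
Qed.

Lemma hermTZ z p : hermT (z *: p) = z *: hermT p.
Proof.
rewrite (@hermTE (size p)) ?size_scale_leq // scaler_sumr.
by apply: eq_bigr => i _; rewrite coefZ scalerA.
Qed.

Lemma hermT0 : hermT 0 = 0.
Proof. by rewrite /hermT size_poly0 big_ord0. Qed.

Lemma hermTN p : hermT (- p) = - hermT p.
Proof. by rewrite -scaleN1r hermTZ scaleN1r. Qed.

Lemma hermTC z : hermT z%:P = z%:P.
Proof. by rewrite (@hermTE 1) ?size_polyC_leq1 // big_ord1 coefC /= alg_polyC. Qed.

Lemma hermTMX p : hermT (p * 'X) = hermT p * 'X - 2^-1 *: deriv (hermT p).
Proof.
rewrite (@hermTE (size p).+1); last first.
  by apply: leq_trans (size_polyMleq _ _) _; rewrite size_polyX addn2.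
rewrite big_ord_recl coefMX eqxx scale0r add0r /hermT mulr_suml linear_sum /=.
rewrite scaler_sumr -sumrB; apply: eq_bigr => i _.
rewrite coefMX /= /herm_raise derivZ.
by rewrite add0n -!mul_polyC; ring.
Qed.

(** Formally [hermT] is exp(-d^2/4), which commutes with the derivation d. *)
Lemma hermT_deriv p : hermT (deriv p) = deriv (hermT p).
Proof.
elim/poly_ind: p => [|p z IH]; first by rewrite hermT0 !deriv0 hermT0.
rewrite derivMXaddC !hermTD !hermTMX hermTC derivD derivB derivM derivX mulr1.
by rewrite derivZ derivC IH; ring.
Qed.

Lemma hermT_MXsubC p t : hermT (p * ('X - t%:P)) =
  hermT p * ('X - t%:P) - 2^-1 *: deriv (hermT p).
Proof.
rewrite !mulrBr hermTD hermTMX -!scaleN1r hermTZ ![_ * t%:P]mulrC !mul_polyC hermTZ.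
by rewrite -!mul_polyC polyCN; ring.
Qed.

Lemma coef_hermT n p : (size p <= n.+1)%N ->
  (size (hermT p) <= n.+1)%N /\ (hermT p)`_n = p`_n.
Proof.
move=> sp; rewrite (hermTE sp); split.
  apply: leq_trans (size_sum _ _ _) _; apply/bigmax_leqP => i _.
  apply: leq_trans (size_scale_leq _ _) _.
  exact: leq_trans (coef_herm i).1 (ltn_ord i).
rewrite coef_sum big_ord_recr /= big1 ?add0r => [|i _].
  by rewrite coefZ (coef_herm n).2 mulr1.
by rewrite coefZ (nth_default _ (leq_trans (coef_herm i).1 (ltn_ord i))) mulr0.
Qed.

Lemma derivn_lead n p : (size p <= n.+1)%N -> derivn n p = (n`!%:R * p`_n)%:P.
Proof.
move=> sp; apply/polyP => i; rewrite coef_derivn coefC; case: i => [|i] /=.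
  by rewrite addn0 ffactnn mulr_natl.
by rewrite nth_default ?mul0rn // (leq_trans sp) // addnS ltnS leq_addr.
Qed.

Lemma size_hermT p : (size (hermT p) <= size p)%N.
Proof.
have [->|pN0] := eqVneq p 0; first by rewrite hermT0.
have /coef_hermT[] : (size p <= (size p).-1.+1)%N by rewrite -polySpred.
by rewrite -polySpred.
Qed.

Lemma hermT_eq0 p : hermT p = 0 -> p = 0.
Proof.
move=> Tp0; apply/eqP; apply: contraT; rewrite -lead_coef_eq0 lead_coefE => /negP[].
have [->|pN0] := eqVneq p 0; first by rewrite coef0.
have /coef_hermT[_ <-] : (size p <= (size p).-1.+1)%N by rewrite polySpred.
by rewrite Tp0 coef0.
Qed.

Lemma hermT_inj : injective hermT.
Proof.
move=> p q /eqP; rewrite -subr_eq0 -scaleN1r -hermTZ -hermTD scaleN1r => /eqP.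
by move=> /hermT_eq0 /eqP; rewrite subr_eq0 => /eqP.
Qed.

(** Conjugation by [hermT] turns multiplication by X into X + d/2, by [hermTMX]; Horner's scheme
    extends this to every polynomial q. *)
Lemma hermT_mul q : exists c, forall p, q * hermT p = hermT (dop c p).
Proof.
elim/poly_ind: q => [|q z [c qT]].
  by exists 0 => p; rewrite mul0r dop0 hermT0.
pose d : {poly {poly K}} := c * 'X + map_poly (@deriv K) c.
(* [d] is the operator [c] followed by a derivation, so the witness is [c] followed by X + d/2, plus
   multiplication by z. *)
exists (c * ('X)%:P + d * (2^-1)%:P%:P + z%:P%:P) => p.
rewrite !dopDl !dopMC dopC -dop_deriv mulrDl -[q * 'X * _]mulrAC qT !hermTD hermTMX.
rewrite [deriv _ * _]mulrC [p * _]mulrC !mul_polyC !hermTZ hermT_deriv.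
by rewrite subrK.
Qed.

Lemma dop_hermT c : exists c', forall p, dop c (hermT p) = hermT (dop c' p).
Proof.
elim/poly_ind: c => [|c q [c1 cT]].
  by exists 0 => p; rewrite !dop0 hermT0.
have [c2 qT] := hermT_mul q.
exists (c1 * 'X + c2) => p.
by rewrite !dopDl !dopMX dopC -hermT_deriv cT mulrC qT hermTD.
Qed.

(** Testing on X^j isolates the coefficient of index j: lower ones vanish by induction, and higher
    derivatives kill a polynomial of degree j. *)
Lemma dop_hermT_eq0 c : (forall p, dop c (hermT p) = 0) -> c = 0.
Proof.
move=> c0; apply/polyP => j; rewrite coef0; elim/ltn_ind: j => j IH.
have [?|ltj] := leqP (size c) j; first exact: nth_default.
have := c0 'X^j; rewrite /dop (bigD1 (Ordinal ltj)) //= big1; last first.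
  move=> i neqij; have [ltij|leji] := ltnP i j; first by rewrite IH ?mulr0.
  have {leji neqij} ltji : (j < i)%N by rewrite ltn_neqAle leji andbT eq_sym.
  rewrite derivn_poly0 ?mul0r // (leq_trans (size_hermT _)) //.
  by rewrite size_polyXn.
have [|sT T1] := @coef_hermT j 'X^j; first by rewrite size_polyXn.
rewrite derivn_lead // T1 coefXn eqxx mulr1 addr0.
move/eqP; rewrite mulf_eq0 polyC_eq0 pnatr_eq0 -leqn0 leqNgt fact_gt0.
by move=> /= /eqP.
Qed.

End HermiteTransform.

(** * Eigenvalues in the monomial model *)

Lemma sum3E (V : nmodType) (F : 'I_3 -> V) : \sum_(l < 3) F l = F 0 + F 1 + F 2.
Proof.
rewrite !big_ord_recl big_ord0 addr0 addrA.
by congr (F _ + F _ + F _); apply: val_inj.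
Qed.

Lemma forall3 (P : 'I_3 -> Prop) : P 0 -> P 1 -> P 2 -> forall i, P i.
Proof.
move=> P0 P1 P2 [[|[|[|//]]] lti].
- by rewrite (_ : Ordinal lti = 0) //; apply: val_inj.
- by rewrite (_ : Ordinal lti = 1) //; apply: val_inj.
- by rewrite (_ : Ordinal lti = 2) //; apply: val_inj.
Qed.

Section Model.
Variable K : numFieldType.
Implicit Types (p q : {poly K}) (d : {poly {poly K}}) (s t u v w z : K).

Lemma XsubC_exp_free2 t n u v (Z := 'X - t%:P) :
  u *: Z ^+ n.+1 + v *: Z ^+ n = 0 -> u = 0 /\ v = 0.
Proof.
rewrite -!mul_polyC exprSr mulrCA [_ * Z ^+ n]mulrC -mulrDr => /eqP.
rewrite mulf_eq0 expf_eq0 polyXsubC_eq0 andbF /= => /eqP uv0.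
have v0 : v = 0.
  have := congr1 (horner^~ t) uv0.
  by rewrite hornerD hornerM !hornerC hornerXsubC subrr mulr0 add0r.
split=> //; have := congr1 (horner^~ (t + 1)) uv0.
by rewrite v0 addr0 hornerM hornerC hornerXsubC addrAC subrr add0r mulr1 hornerC.
Qed.

Lemma XsubC_exp_free3 t n u v w (Z := 'X - t%:P) :
  u *: Z ^+ n.+2 + v *: Z ^+ n.+1 + w *: Z ^+ n = 0 -> [/\ u = 0, v = 0 & w = 0].
Proof.
move=> uvw0.
have w0 : w = 0.
  have : Z ^+ n * (Z * (u *: Z + v%:P) + w%:P) = 0.
    by rewrite -uvw0 -!mul_polyC !exprS; ring.
  move/eqP; rewrite mulf_eq0 expf_eq0 polyXsubC_eq0 andbF /= => /eqP.
  move/(congr1 (horner^~ t)).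
  by rewrite hornerD hornerM hornerXsubC subrr mul0r add0r !hornerC.
by move: uvw0; rewrite w0 scale0r addr0 => /XsubC_exp_free2[].
Qed.

Lemma Xn_free2 n u v : u *: 'X^(n.+1) + v *: 'X^n = 0 :> {poly K} -> u = 0 /\ v = 0.
Proof.
by move=> uv0; apply: (@XsubC_exp_free2 0 n); rewrite subr0.
Qed.

Lemma dop_Xn_dvd d n : 'X^(n - size d) %| dop d 'X^n.
Proof. by have := dop_exp_dvd d n 0; rewrite subr0. Qed.

Lemma dop_pair_eq0l d e t z N r : t != 0 ->
  (forall n, (N <= n)%N -> 'X^(n - r) %| dop d (('X - t%:P) ^+ n) + z *: dop e 'X^(n.+1)) ->
  d = 0.
Proof.
move=> t0 dvd_de; pose r' := (r + size e)%N.
apply: (@dop_eq0_of_dvd _ d 0 t N r'); first by rewrite eq_sym.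
move=> n /dvd_de dvdn; rewrite subr0.
have dvde : 'X^(n - r') %| z *: dop e 'X^(n.+1).
  rewrite -mul_polyC dvdp_mull //; apply: dvdp_trans (dop_Xn_dvd e n.+1).
  by rewrite dvdp_exp2l //; lia.
rewrite -(dvdp_addl _ dvde); apply: dvdp_trans dvdn.
by rewrite dvdp_exp2l //; lia.
Qed.

(** Same argument with the points exchanged: the term in [d] is divisible by a high power of X - t.
    The shift from n to n+1 accounts for [N.+1] and the successor in [r']. *)
Lemma dop_pair_eq0r d e t z N r : t != 0 -> z != 0 ->
  (forall n, (N <= n)%N ->
    ('X - t%:P) ^+ (n - r) %| dop d (('X - t%:P) ^+ n) + z *: dop e 'X^(n.+1)) ->
  e = 0.
Proof.
move=> t0 z0 dvd_de; pose r' := (r + size d).+1.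
apply: (@dop_eq0_of_dvd _ e t 0 N.+1 r') => // -[//|n] /dvd_de dvdn; rewrite subr0.
have dvdd : ('X - t%:P) ^+ (n.+1 - r') %| dop d (('X - t%:P) ^+ n).
  apply: dvdp_trans (dop_exp_dvd d n t); rewrite dvdp_exp2l //.
  by rewrite /r'; lia.
rewrite -(dvdpZr _ _ z0) -(dvdp_addr _ dvdd); apply: dvdp_trans dvdn.
by rewrite dvdp_exp2l // /r'; lia.
Qed.

Variables (a b c k : K).

(* Preimage under [hermT] of the straightened orthogonal polynomials. *)
Definition model n : 'M[{poly K}]_3 :=
  mx3 (('X - b%:P) ^+ n) (a *: 'X^(n.+1)) 0
      0 (c *: 'X^(n.+1)) 'X^n
      (- (k * a * n%:R / 2) *: ('X - b%:P) ^+ n.-1) 'X^n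
        (- (c * n%:R / 2) *: 'X^(n.-1)).

Hypotheses (a0 : a != 0) (b0 : b != 0) (c0 : c != 0) (k0 : k != 0).

Section Intertwiner.
Variables (phi : 'I_3 -> 'I_3 -> {poly {poly K}}) (G : nat -> 'M[K]_3).
Hypothesis phiG : forall n i j, \sum_l dop (phi l j) (model n i l) =
  \sum_l G n i l *: model n l j.

Let Y := 'X - b%:P.

(** [eq0], [eq1] and [eq2] are the three rows of the intertwining relation, with the column left
    generic. *)
Let eq0 j n : dop (phi 0 j) (Y ^+ n) + a *: dop (phi 1 j) 'X^(n.+1) =
  G n 0 0 *: model n 0 j + G n 0 1 *: model n 1 j + G n 0 2 *: model n 2 j.
Proof.
by have := phiG n 0 j; rewrite !sum3E ![model n 0 _]mxE /= dop0r addr0 dopZ => ->.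
Qed.

Let eq1 j n : c *: dop (phi 1 j) 'X^(n.+1) + dop (phi 2 j) 'X^n =
  G n 1 0 *: model n 0 j + G n 1 1 *: model n 1 j + G n 1 2 *: model n 2 j.
Proof.
by have := phiG n 1 j; rewrite !sum3E ![model n 1 _]mxE /= dop0r add0r dopZ => ->.
Qed.

Let eq2 j n : - (k * a * n%:R / 2) *: dop (phi 0 j) (Y ^+ n.-1)
    + dop (phi 1 j) 'X^n - (c * n%:R / 2) *: dop (phi 2 j) 'X^(n.-1) =
  G n 2 0 *: model n 0 j + G n 2 1 *: model n 1 j + G n 2 2 *: model n 2 j.
Proof.
have := phiG n 2 j; rewrite !sum3E ![model n 2 _]mxE /= !dopZ => <-.
by rewrite -[- (_ *: dop (phi 2 j) _)]scaleNr.
Qed.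

(** Uniqueness: an operator is determined by its eigenvalue matrices for large n. Row 0 separates
    powers of X - b from powers of X and so kills two rows of [phi]; row 1 then kills the last. *)
Lemma model_annihilator N :
  (forall n, (N <= n)%N -> G n = 0) -> forall i j, phi i j = 0.
Proof.
move=> G0 i j.
have e0 n : (N <= n)%N -> dop (phi 0 j) (Y ^+ n) + a *: dop (phi 1 j) 'X^(n.+1) = 0.
  by move=> /G0 Gn; rewrite eq0 Gn !mxE !scale0r !addr0.
have phi0 : phi 0 j = 0.
  by apply: (@dop_pair_eq0l _ (phi 1 j) b a N 0) => // n /e0 ->; exact: dvdp0.
have phi1 : phi 1 j = 0.
  by apply: (@dop_pair_eq0r (phi 0 j) _ b a N 0) => // n /e0 ->; exact: dvdp0.
have phi2 : phi 2 j = 0.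
  apply: (@dop_eq0_XsubC _ _ 0 N) => n /G0 Gn; rewrite subr0.
  by have := eq1 j n; rewrite phi1 dop0 scaler0 add0r => ->; rewrite Gn !mxE !scale0r !addr0.
by elim/forall3: i.
Qed.

(** Column 0 of the model contains only powers of X - b, columns 1 and 2 only powers of X, all with
    exponent at least n - 1. The divisibility criteria with r = 1 therefore annihilate the four
    entries of [phi] that mix coordinate 0 with the others. *)
Let phi01 : phi 0 1 = 0.
Proof.
apply: (@dop_pair_eq0l _ (phi 1 1) b a 0 1) => // n _; rewrite eq0 !mxE /=.
rewrite !dvdp_add // -mul_polyC dvdp_mull // -?mul_polyC ?dvdp_mull // dvdp_exp2l //; lia.
Qed.

Let phi02 : phi 0 2 = 0.
Proof.
apply: (@dop_pair_eq0l _ (phi 1 2) b a 0 1) => // n _; rewrite eq0 !mxE /=.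
rewrite !dvdp_add // -mul_polyC dvdp_mull // -?mul_polyC ?dvdp_mull ?dvdp0 // dvdp_exp2l //; lia.
Qed.

Let phi10 : phi 1 0 = 0.
Proof.
apply: (@dop_pair_eq0r (phi 0 0) _ b a 0 1) => // n _; rewrite eq0 !mxE /=.
rewrite !dvdp_add // -mul_polyC dvdp_mull // -?mul_polyC ?dvdp_mull ?dvdp0 // dvdp_exp2l //; lia.
Qed.

Let phi20 : phi 2 0 = 0.
Proof.
apply: (@dop_eq0_of_dvd _ _ b 0 0 1) => // n _; rewrite subr0.
have := eq1 0 n; rewrite phi10 dop0 scaler0 add0r => ->; rewrite !mxE /=.
rewrite !dvdp_add // -mul_polyC dvdp_mull // -?mul_polyC ?dvdp_mull ?dvdp0 // dvdp_exp2l //; lia.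
Qed.

Let kan0 n : k * a * n.+1%:R / 2 != 0.
Proof. by rewrite !mulf_neq0 ?invr_eq0 ?pnatr_eq0. Qed.

Let G1 n : G n.+1 1 0 = 0 /\ G n.+1 1 2 = 0.
Proof.
have := eq1 0 n.+1; rewrite phi10 phi20 !dop0 scaler0 addr0 !mxE /= scaler0 addr0.
rewrite scalerA => /esym /XsubC_exp_free2[-> /eqP].
by rewrite mulf_eq0 oppr_eq0 (negPf (kan0 n)) orbF => /eqP ->.
Qed.

(** Row 0 at n+1 and row 2 at n+2 both contain the image of [Y ^+ n.+1] under [phi 0 0]. Eliminating
    it leaves a linear relation between three consecutive powers of Y, whose coefficients must
    vanish. *)
Let diag00 n : [/\ dop (phi 0 0) (Y ^+ n.+1) = G n.+1 0 0 *: Y ^+ n.+1,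
  G n.+1 0 2 = 0, G n.+2 2 0 = 0 & G n.+2 2 2 = G n.+1 0 0].
Proof.
have := eq0 0 n.+1; rewrite phi10 dop0 scaler0 addr0 !mxE /= scaler0 addr0 => e0.
have := eq2 0 n.+2; rewrite phi10 phi20 !dop0 scaler0 addr0 subr0 !mxE /= scaler0 addr0.
rewrite e0 => e2.
have kan := kan0 n.+1; set z := k * a * n.+2%:R / 2 in kan e2; clearbody z.
have /XsubC_exp_free3[G20 /eqP GG /eqP G02] :
  G n.+2 2 0 *: Y ^+ n.+2 + (z * (G n.+1 0 0 - G n.+2 2 2)) *: Y ^+ n.+1
   + (- (z * G n.+1 0 2 * (k * a * n.+1%:R / 2))) *: Y ^+ n = 0.
  apply/eqP; rewrite -(subr_eq0 _ 0) subr0.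
  move/eqP: e2; rewrite eq_sym -subr_eq0; congr (_ == _).
  by rewrite -/Y -!mul_polyC !(polyCN, polyCM, polyCB); ring.
move: GG; rewrite mulf_eq0 (negPf kan) subr_eq0 /= => /eqP GG.
move: G02 (kan0 n); set y := k * a * n.+1%:R / 2; clearbody y => G02 y0.
move: G02; rewrite oppr_eq0 !mulf_eq0 (negPf kan) (negPf y0) orbF => /eqP G02.
by split=> //; rewrite G02 scale0r addr0.
Qed.

(** [A] comes from the action of [phi 0 0] on powers of X - b, and q from [phi 1 2], which lowers
    the degree by one. The other entries are forced by comparing rows. Indices start at 2 because
    row 2 at n+2 is tied to row 0 at n+1. *)
Theorem model_eigenvalues : exists A q : {poly K}, forall n,
  G n.+2 = mx3 A.[n.+2%:R] (a * c / 2 * n.+3%:R * q.[n.+2%:R]) 0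
               0 (A.[n.+2%:R] + (1 + c ^+ 2 * n.+3%:R / 2) * q.[n.+2%:R]) 0
               0 0 A.[n.+1%:R].
Proof.
have [A GA] : exists A : {poly K}, forall n, (1 <= n)%N -> G n 0 0 = A.[n%:R].
  apply: (@dop_diag_poly _ (phi 0 0) b) => -[//|n] _; by have [] := diag00 n.
have [Q GQ] : exists Q : {poly K}, forall n, (1 <= n)%N ->
    a^-1 * G n 0 1 = n.+1%:R * Q.[n%:R].
  apply: (@dop_lower_poly _ (phi 1 2)) => -[//|n] _.
  have [_ G02 _ _] := diag00 n.
  have := eq0 2 n.+1; rewrite phi02 dop0 add0r G02 !mxE /= scaler0 scale0r add0r addr0.
  by move=> /(congr1 ( *:%R a^-1)); rewrite !scalerA mulVf // scale1r.
have step n (q := 2 / c * Q.[n.+1%:R]) : [/\ G n.+1 0 1 = a * c / 2 * n.+2%:R * q,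
    G n.+1 1 1 = A.[n.+1%:R] + (1 + c ^+ 2 * n.+2%:R / 2) * q & G n.+2 2 1 = 0].
  have [_ G02 G20 G22] := diag00 n; have [G10 G12] := G1 n.
  have e01 := eq0 1 n.+1; have e11 := eq1 1 n.+1; have e21 := eq2 1 n.+2.
  move: e01 e11 e21; rewrite !mxE /= phi01 !dop0 G02 G20 G22 G10 G12 GA //.
  rewrite !(scale0r, scaler0, add0r, addr0).
  have G01 : G n.+1 0 1 = a * (n.+2%:R * Q.[n.+1%:R]).
    by rewrite -[LHS](mulVKf a0) GQ.
  rewrite G01; set P := 'X^(n.+2); set P' := 'X^(n.+3); set m := n.+2%:R.
  set x := A.[_]; set y := Q.[_] in q *; set g := G n.+1 1 1; set h := G n.+2 2 1.
  have m0 : m != 0 by rewrite pnatr_eq0.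
  clearbody m; move=> e01 e11 e21.
  have f11 : dop (phi 1 1) P = (x + c * m * y) *: P.
    by apply: (scalerI a0); rewrite e01 -!mul_polyC !(polyCM, polyCD); ring.
  have f21 : dop (phi 2 1) 'X^(n.+1) = (c * (g - x - c * m * y)) *: P.
    apply: (addrI (c *: dop (phi 1 1) P)); rewrite e11 f11 -!mul_polyC.
    by rewrite !(polyCM, polyCD, polyCN); ring.
  (* Row 2 at n+2 becomes a relation between two powers of X: one coefficient gives h = 0, the other
     a linear equation for g. *)
  have /Xn_free2[/eqP ch eg] : (- (h * c)) *: P' +
      (c * m * y - c * m / 2 * (c * (g - x - c * m * y))) *: P = 0.
    move/eqP: e21; rewrite f11 f21 -subr_eq0 => /eqP <-.
    by rewrite -!mul_polyC !(polyCM, polyCD, polyCN); ring.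
  move: ch; rewrite oppr_eq0 mulf_eq0 (negPf c0) orbF => /eqP h0.
  split=> //; first by rewrite /q; field; rewrite c0.
  (* The solution of [eg] for g, written as the expected value minus a multiple of the vanishing
     left-hand side. *)
  have -> : g = x + (1 + c ^+ 2 * m / 2) * q
      - 2 / (c ^+ 2 * m) * (c * m * y - c * m / 2 * (c * (g - x - c * m * y))).
    by rewrite /q; field; rewrite c0 m0.
  by rewrite eg mulr0 subr0.
exists A, ((2 / c) *: Q) => n.
have [_ _ G20 G22] := diag00 n; have [_ G02 _ _] := diag00 n.+1.
have [G10 G12] := G1 n.+1; have [_ _ G21] := step n; have [G01 G11 _] := step n.+1.
apply/matrixP => i j; elim/forall3: i; elim/forall3: j; rewrite [RHS]mxE /= ?hornerZ //.
  by rewrite GA.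
by rewrite G22 GA.
Qed.

End Intertwiner.
End Model.

(** * Straightening the weight *)

Section Straightening.
Variable K : numFieldType.
Local Notation MP := 'M[{poly K}]_3.
Implicit Types (P U : MP) (D E : {poly MP}).

Definition dentry D (l j : 'I_3) : {poly {poly K}} :=
  map_poly (fun F : MP => F l j) D.

Lemma coef_dentry D l j i : (dentry D l j)`_i = D`_i l j.
Proof. by rewrite coef_map_id0 // mxE. Qed.

Lemma dact_entry P D i j : dact P D i j = \sum_l dop (dentry D l j) (P i l).
Proof.
have sD l : (size (dentry D l j) <= size D)%N.
  by apply/leq_sizeP => m sm; rewrite coef_dentry nth_default // mxE.
rewrite /dact summxE; under [RHS]eq_bigr do rewrite (dopE _ (sD _)).
rewrite exchange_big /=; apply: eq_bigr => m _; rewrite mxE; apply: eq_bigr => l _.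
by rewrite mxE coef_dentry.
Qed.

Lemma dentry_eq0 D : (forall l j, dentry D l j = 0) -> D = 0.
Proof.
move=> D0; apply/polyP => i; apply/matrixP => l j.
by rewrite -coef_dentry D0 !coef0 mxE.
Qed.

Lemma dact_polyC P U : dact P U%:P = P *m U.
Proof. by rewrite -[U%:P]mul1r dactMC dact1. Qed.

Variables (a b c k : K).

(* W = straight * diag(e^(-x^2 + 2 b x), e^(-x^2), e^(-x^2)) * straight^*
   (see [innerE]). *)
Definition straight : MP := mx3 1 (a%:P * 'X) 0 0 1 0 0 (c%:P * 'X) 1.
Definition unstraight : MP := mx3 1 (- (a%:P * 'X)) 0 0 1 0 0 (- (c%:P * 'X)) 1.

Lemma straightK : straight *m unstraight = 1%:M.
Proof.
apply/matrixP => i j; rewrite mxE sum3E.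
elim/forall3: i; elim/forall3: j; rewrite !mxE /=; ring.
Qed.

Lemma unstraightK : unstraight *m straight = 1%:M.
Proof. exact: (mulmx1C straightK). Qed.

(** The Hermite transform produces polynomials adapted to the diagonal weight; [unstraight] carries
    them back to [W]. *)
Definition orthS n : MP := map_mx (@hermT K) (model a b c k n) *m unstraight.

Definition straighten D : {poly MP} := dmul (dmul unstraight%:P D) straight%:P.

Lemma dact_straighten U D : dact U (straighten D) = dact (U *m unstraight) D *m straight.
Proof. by rewrite /straighten !dact_mul !dact_polyC. Qed.

Lemma straighten_eq0 D : straighten D = 0 -> D = 0.
Proof.
move=> D0; apply: dact_inj => P; rewrite dact0.
have := dact_straighten (P *m straight) D.
rewrite D0 dact0 -mulmxA straightK mulmx1 => /(congr1 (mulmxr unstraight)) /=.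
by rewrite mul0mx -mulmxA straightK mulmx1.
Qed.

(** Conjugating by [straight] and then entrywise by [hermT] moves the eigenvalue relation to the
    monomial model. Both conjugations are injective, so vanishing can be tested there. *)
Lemma straighten_model D (G : nat -> 'M[K]_3) :
  (forall n, dact (orthS n) D = map_mx polyC (G n) *m orthS n) ->
  exists phi : 'I_3 -> 'I_3 -> {poly {poly K}},
    (forall n i j, \sum_l dop (phi l j) (model a b c k n i l) =
       \sum_l G n i l *: model a b c k n l j) /\
    ((forall l j, phi l j = 0) -> D = 0).
Proof.
move=> DG; pose E := straighten D.
have /fin_all_exists[phi phiE] (lj : 'I_3 * 'I_3) : exists d, forall p : {poly K},
    dop (dentry E lj.1 lj.2) (hermT p) = hermT (dop d p) by exact: dop_hermT.
exists (fun l j => phi (l, j)); split=> [n i j|phi0].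
  have /matrixP/(_ i j) :
      dact (map_mx (@hermT K) (model a b c k n)) E =
      map_mx polyC (G n) *m map_mx (@hermT K) (model a b c k n).
    by rewrite dact_straighten -/(orthS n) DG /orthS -!mulmxA unstraightK mulmx1.
  rewrite dact_entry mxE !sum3E !mxE !(phiE (_, j)) !mul_polyC -!hermTZ -!hermTD.
  exact: hermT_inj.
apply/straighten_eq0/dentry_eq0 => l j; apply: dop_hermT_eq0 => p.
by rewrite (phiE (l, j)) phi0 dop0 hermT0.
Qed.

(** The second-order Hermite operator centred at t becomes a multiple of the Euler operator (X - t)
    d, which is diagonal on powers of X - t. *)
Lemma hermT_delta (t : K) (p : {poly K}) :
  deriv (deriv (hermT p)) - 2 *: (('X - t%:P) * deriv (hermT p)) =
  hermT (- 2 *: (('X - t%:P) * deriv p)).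
Proof.
rewrite hermTZ mulrC [_ * deriv p]mulrC hermT_MXsubC hermT_deriv scalerBr scalerA.
rewrite mulNr divff ?pnatr_eq0 // scaleN1r opprK scaleNr addrC; congr (_ + _).
Qed.

(** [model_act1] and [model_act2] are the two operators after straightening and Hermite transform,
    as [dact_gD1] and [dact_gD2] show; both have order one. *)
Definition model_act1 U : MP := \matrix_(i, j) (nth 0 [::
   - 2 *: (('X - b%:P) * deriv (U i 0));
   - 2 *: ('X * deriv (U i 1)) + 2 *: U i 1;
   - 2 *: ('X * deriv (U i 2)) ] j).

Definition model_act2 U : MP := \matrix_(i, j) (nth 0 [::
   (2 + 4 / c ^+ 2) *: U i 0;
   - 2 *: ('X * deriv (U i 1)) + (2 + 4 / c ^+ 2) *: U i 1 - (4 / c) *: ('X * U i 2);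
   - (2 / c) *: deriv (U i 1) + 2 *: U i 2 ] j).

Definition eigen1 n : 'M[K]_3 := mx3 (- 2 * n%:R) 0 0 0 (- 2 * n%:R) 0 0 0 (2 - 2 * n%:R).

Definition eigen2 n : 'M[K]_3 :=
  mx3 (2 + 4 / c ^+ 2) (- (2 * a / c * n.+1%:R)) 0
      0 (- 2 * n%:R) 0
      0 0 (2 + 4 / c ^+ 2).

Let mul_derivXn n : 'X * deriv 'X^n = n%:R *: 'X^n :> {poly K}.
Proof.
case: n => [|n]; first by rewrite expr0 derivC mulr0 scale0r.
by rewrite derivXn mulrnAr scaler_nat exprS.
Qed.

Let mul_derivXsubCn n t (Z := 'X - t%:P) : Z * deriv (Z ^+ n) = n%:R *: Z ^+ n :> {poly K}.
Proof.
case: n => [|n]; first by rewrite expr0 derivC mulr0 scale0r.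
by rewrite deriv_exp derivXsubC mul1r mulrnAr scaler_nat exprS.
Qed.

Let deriv_Xn n : deriv 'X^n = n%:R * 'X^(n.-1) :> {poly K}.
Proof. by rewrite derivXn mulr_natl. Qed.

Hypothesis c0 : c != 0.

Let polyc0 : c%:P * (c^-1)%:P = 1.
Proof. by rewrite -polyCM divff. Qed.

Lemma model_eigen1 n :
  model_act1 (model a b c k n) = map_mx polyC (eigen1 n) *m model a b c k n.
Proof.
apply/matrixP => i j; rewrite [RHS]mxE sum3E.
by case: n => [|n]; elim/forall3: i; elim/forall3: j; rewrite !mxE /=
  ?derivZ -?scalerAr ?mul_derivXn ?mul_derivXsubCn ?deriv0 -!mul_polyC
  !(polyCM, polyCN, polyCB, polyC_natr); ring.
Qed.

Let polyC4 : 4 * (2^-1)%:P = 2 :> {poly K}.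
Proof. by rewrite -!polyC_natr -polyCM; congr _%:P; field. Qed.

Let polyc4 : 4 * (c%:P * (c^-1)%:P * (c^-1)%:P * (2^-1)%:P) = 2 * (c^-1)%:P.
Proof. by rewrite polyc0 -polyC4; ring. Qed.

Lemma model_eigen2 n :
  model_act2 (model a b c k n) = map_mx polyC (eigen2 n) *m model a b c k n.
Proof.
apply/matrixP => i j; rewrite [RHS]mxE sum3E.
case: n => [|n]; elim/forall3: i; elim/forall3: j; rewrite !mxE /=
  ?derivZ -?scalerAr ?mul_derivXn ?mul_derivXsubCn ?deriv_Xn ?deriv0 -!mul_polyC /=
  -?exprVn !(polyC_natr, polyCM, polyCN, polyCB, polyCD, polyC_exp);
  rewrite ?(exprS, polyC0); try move: ('X^n) => x; try move: (('X - b%:P) ^+ n) => y;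
  try (ring: polyc0 polyC4).
(* The lower right entry remains; the product of c with two inverses of c is isolated so that
   [polyc4] applies. *)
move: (n.+1%:R : {poly K}) => m.
transitivity (- (c%:P * m * (2^-1)%:P) * (2 * x)
  - (4 * (c%:P * (c^-1)%:P * (c^-1)%:P * (2^-1)%:P)) * (m * x)); last by ring.
by rewrite polyc4; ring.
Qed.

End Straightening.

(** * Action of the two operators in straightened, transformed coordinates *)

Section OperatorAction.
Variables (K : numFieldType) (a b c : K).
Hypothesis c0 : c != 0.
Local Notation MP := 'M[{poly K}]_3.
Implicit Types (P V F : MP).

Lemma mulmx3E (T : pzRingType) (P F : 'M[T]_3) i j :
  (P *m F) i j = P i 0 * F 0 j + P i 1 * F 1 j + P i 2 * F 2 j.
Proof. by rewrite mxE sum3E. Qed.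

Lemma dact_mkdiffop3 P F0 F1 F2 : dact P (mkdiffop [:: F0; F1; F2]) =
  P *m F0 + mxderivn 1 P *m F1 + mxderivn 2 P *m F2.
Proof.
rewrite (@dactE _ _ 3) ?size_Poly //.
rewrite !big_ord_recl big_ord0 addr0 !coef_Poly /= addrA; congr (_ *m _ + _ + _).
by apply/matrixP=> i j; rewrite mxE derivn0.
Qed.

Lemma dact_mkdiffop3E P F0 F1 F2 i j : dact P (mkdiffop [:: F0; F1; F2]) i j =
  (P i 0 * F0 0 j + P i 1 * F0 1 j + P i 2 * F0 2 j)
  + (deriv (P i 0) * F1 0 j + deriv (P i 1) * F1 1 j + deriv (P i 2) * F1 2 j)
  + (deriv (deriv (P i 0)) * F2 0 j + deriv (deriv (P i 1)) * F2 1 j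
     + deriv (deriv (P i 2)) * F2 2 j).
Proof.
rewrite dact_mkdiffop3 mxE [X in X + _]mxE !mulmx3E.
by rewrite ![mxderivn _ _ _ _]mxE !derivnS !derivn0.
Qed.

(** [D1] and [D2] with parameters in the coefficient field itself; [D1_gD1] and [D2_gD2] specialize
    them to embedded reals. *)
Definition gD1 : diffop K 2 := mkdiffop
  [:: mx3 0 0 0
          0 2 0
          0 0 0;
      mx3 ((2 * b)%:P - 2 *: 'X) (- (2 * a * b)%:P * 'X + (2 * a)%:P) 0
          0                       (- (2 *: 'X))                          0
          0                       (2 * c)%:P                 (- (2 *: 'X));
      1%:M].

Definition gD2 : diffop K 2 := mkdiffop
  [:: mx3 (2 + 4 / c ^+ 2)%:P 0                    (- (2 * a / c)%:P)
          0                    (2 + 4 / c ^+ 2)%:P 0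
          0                    0                    0;
      mx3 0 (2 * a)%:P         (- (2 * a / c)%:P * 'X)
          0 0                   (- (2 / c)%:P)
          0 (2 * c + 2 / c)%:P (- (2 *: 'X));
      mx3 0 (a%:P * 'X) 0
          0 1            0
          0 (c%:P * 'X) 0].

Let polyc0 : c%:P * (c^-1)%:P = 1.
Proof. by rewrite -polyCM divff. Qed.

Let polyC4 : 4 * (2^-1)%:P = 2 :> {poly K}.
Proof. by rewrite -!polyC_natr -polyCM; congr _%:P; field. Qed.

Lemma unstraightE (P : MP) i : [/\ (P *m unstraight a c) i 0 = P i 0,
  (P *m unstraight a c) i 1 = P i 1 - a%:P * 'X * P i 0 - c%:P * 'X * P i 2
  & (P *m unstraight a c) i 2 = P i 2].
Proof. by rewrite !mulmx3E ![unstraight _ _ _ _]mxE /=; split; ring. Qed.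

Lemma hermT_delta0 p : deriv (deriv (hermT p)) - 2 *: ('X * deriv (hermT p)) =
  hermT (- 2 *: ('X * deriv p)) :> {poly K}.
Proof. by have := hermT_delta 0 p; rewrite subr0. Qed.

Lemma dact_gD1 V :
  dact (map_mx (@hermT K) V *m unstraight a c) gD1 =
  map_mx (@hermT K) (model_act1 b V) *m unstraight a c.
Proof.
apply/matrixP => i j; rewrite dact_mkdiffop3E.
have [-> -> ->] := unstraightE (map_mx (@hermT K) V) i.
have [e0 e1 e2] := unstraightE (map_mx (@hermT K) (model_act1 b V)) i.
rewrite ![map_mx _ V _ _]mxE.
have v0 : hermT (model_act1 b V i 0) = deriv (deriv (hermT (V i 0)))
   - 2 *: (('X - b%:P) * deriv (hermT (V i 0))).
  by rewrite mxE /= hermT_delta.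
have v1 : hermT (model_act1 b V i 1) = deriv (deriv (hermT (V i 1)))
   - 2 *: ('X * deriv (hermT (V i 1))) + 2 *: hermT (V i 1).
  by rewrite mxE /= hermTD [hermT (2 *: _)]hermTZ hermT_delta0.
have v2 : hermT (model_act1 b V i 2) = deriv (deriv (hermT (V i 2)))
   - 2 *: ('X * deriv (hermT (V i 2))).
  by rewrite mxE /= hermT_delta0.
move: e0 e1 e2; rewrite ![map_mx _ (model_act1 b V) _ _]mxE v0 v1 v2.
(* The transform has done its work: the remaining identities hold for arbitrary polynomials u0, u1,
   u2. *)
move: (hermT (V i 0)) (hermT (V i 1)) (hermT (V i 2)) => u0 u1 u2 e0 e1 e2.
elim/forall3: j; rewrite ?e0 ?e1 ?e2 ![mx3 _ _ _ _ _ _ _ _ _ _ _]mxE ![1%:M _ _]mxE /=.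
all: rewrite ?e0 ?e1 ?e2 !(derivD, derivB, derivN, derivM, derivC, derivX) -!mul_polyC
   !(polyC_natr, polyCM, polyCN) /=; ring.
Qed.

Lemma dact_gD2 V :
  dact (map_mx (@hermT K) V *m unstraight a c) gD2 =
  map_mx (@hermT K) (model_act2 c V) *m unstraight a c.
Proof.
apply/matrixP => i j; rewrite dact_mkdiffop3E.
have [-> -> ->] := unstraightE (map_mx (@hermT K) V) i.
have [e0 e1 e2] := unstraightE (map_mx (@hermT K) (model_act2 c V)) i.
rewrite ![map_mx _ V _ _]mxE.
have v0 : hermT (model_act2 c V i 0) = (2 + 4 / c ^+ 2) *: hermT (V i 0).
  by rewrite mxE /= hermTZ.
have v1 : hermT (model_act2 c V i 1) = deriv (deriv (hermT (V i 1)))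
   - 2 *: ('X * deriv (hermT (V i 1))) + (2 + 4 / c ^+ 2) *: hermT (V i 1)
   - (4 / c) *: (hermT (V i 2) * 'X - 2^-1 *: deriv (hermT (V i 2))).
  rewrite mxE /= -scaleNr !hermTD [hermT (_ *: V i 1)]hermTZ hermT_delta0.
  rewrite -[- (_ *: (hermT _ * 'X - _))]scaleNr.
  by rewrite [hermT (_ *: ('X * V i 2))]hermTZ ['X * V i 2]mulrC hermTMX.
have v2 : hermT (model_act2 c V i 2) =
    - (2 / c) *: deriv (hermT (V i 1)) + 2 *: hermT (V i 2).
  by rewrite mxE /= hermTD !hermTZ hermT_deriv.
move: e0 e1 e2; rewrite ![map_mx _ (model_act2 c V) _ _]mxE v0 v1 v2.
move: (hermT (V i 0)) (hermT (V i 1)) (hermT (V i 2)) => u0 u1 u2 e0 e1 e2.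
elim/forall3: j; rewrite ?e0 ?e1 ?e2 ![mx3 _ _ _ _ _ _ _ _ _ _ _]mxE /=.
all: rewrite !(derivD, derivB, derivN, derivM, derivC, derivX) -!mul_polyC
   -?exprVn !(polyC_natr, polyCM, polyCN, polyCD, polyC_exp) /=.
all: ring: polyc0 polyC4.
Qed.


End OperatorAction.

(** * Left multiplication by constant matrices and expansion in a graded sequence *)

Section MatrixPolynomials.
Variables (K : numFieldType) (N : nat).
Local Notation MP := 'M[{poly K}]_N.+1.
Implicit Types (P Q : MP) (D : {poly MP}).

Lemma mxderivn_mull j (A : 'M[K]_N.+1) P :
  mxderivn j (map_mx polyC A *m P) = map_mx polyC A *m mxderivn j P.
Proof.
apply/matrixP => i l; rewrite !mxE linear_sum; apply: eq_bigr => m _.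
by rewrite /= !mxE !mul_polyC derivnZ.
Qed.

Lemma dact_mull (A : 'M[K]_N.+1) P D :
  dact (map_mx polyC A *m P) D = map_mx polyC A *m dact P D.
Proof.
rewrite /dact mulmx_sumr; apply: eq_bigr => j _.
by rewrite mxderivn_mull mulmxA.
Qed.

Lemma coefp_mull k (A : 'M[K]_N.+1) P :
  map_mx (coefp k) (map_mx polyC A *m P) = A *m map_mx (coefp k) P.
Proof.
apply/matrixP => i l; rewrite !mxE /= coef_sum; apply: eq_bigr => m _.
by rewrite !mxE /= coefCM.
Qed.

(** Since the leading coefficient of [S k] is invertible, a left multiple of [S k] cancels the
    coefficient of degree k and induction handles the remainder. *)
Lemma mxdegree_span (S : nat -> MP) :
  (forall k, (forall i j, (size (S k i j) <= k.+1)%N) /\ map_mx (coefp k) (S k) \in unitmx) ->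
  forall k P, (forall i j, (size (P i j) <= k)%N) ->
    exists G : nat -> 'M[K]_N.+1, P = \sum_(j < k) map_mx polyC (G j) *m S j.
Proof.
move=> degS; elim=> [|k IH] P sP.
  exists (fun=> 0); rewrite big_ord0; apply/matrixP => i j; rewrite mxE.
  by apply/eqP; rewrite -size_poly_eq0 -leqn0.
have [sS uS] := degS k; pose A := map_mx (coefp k) P *m invmx (map_mx (coefp k) (S k)).
have [|G PG] := IH (P - map_mx polyC A *m S k).
  move=> i j; apply/leq_sizeP => l; rewrite leq_eqVlt => /predU1P[<-|ltkl].
    have := congr1 (fun M : 'M[K]_N.+1 => M i j) (coefp_mull k A (S k)).
    rewrite /A mulmxKV // -/A 2!mxE /= => e; rewrite !mxE coefB.
    by rewrite mxE in e; rewrite e subrr.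
  apply/leq_sizeP: l ltkl; rewrite !mxE (leq_trans (size_polyD _ _)) // geq_max sP size_polyN.
  apply: leq_trans (size_sum _ _ _) _; apply/bigmax_leqP => l _.
  rewrite mxE mul_polyC; exact: leq_trans (size_scale_leq _ _) (sS l j).
exists (fun j => if j == k then A else G j).
rewrite big_ord_recr /= eqxx; under eq_bigr => j _ do rewrite ltn_eqF //.
by rewrite -PG subrK.
Qed.

End MatrixPolynomials.

(** * Degrees and leading coefficients of the candidate orthogonal polynomials *)

Section OrthSDegree.
Variables (K : numFieldType) (a b c k : K).

(* Coefficients of [orthS n] with respect to the Hermite polynomials, which
   expose its degree. *)
Definition orthS_pre n : 'M[{poly K}]_3 :=
  let Y := 'X - b%:P in
  mx3 (Y ^+ n) (a *: ('X^n * 'X - Y ^+ n * 'X - 2^-1 *: deriv (Y ^+ n))) 0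
      0 (- (c / 2) *: deriv 'X^n) 'X^n
      (- (k * a * n%:R / 2) *: Y ^+ n.-1)
      ('X^n + (k * a ^+ 2 * n%:R / 2) *: (Y ^+ n.-1 * 'X + 2^-1 *: deriv (Y ^+ n.-1))
        + (c ^+ 2 * n%:R / 2) *: ('X^(n.-1) * 'X + 2^-1 *: deriv 'X^(n.-1)))
      (- (c * n%:R / 2) *: 'X^(n.-1)).

Lemma orthS_preE n : orthS a b c k n = map_mx (@hermT K) (orthS_pre n).
Proof.
apply/matrixP => i j; rewrite /orthS.
have [e0 e1 e2] := unstraightE a c (map_mx (@hermT K) (model a b c k n)) i.
elim/forall3: j; rewrite ?e0 ?e1 ?e2 !mxE.
all: elim/forall3: i {e0 e1 e2} => /=.
all: rewrite ?(exprSr 'X n) ?(hermTD, hermTN, hermTZ, hermTMX, hermT_deriv, hermT0).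
all: rewrite -?mul_polyC ?(polyCM, polyCN, polyC_exp); ring.
Qed.

Let sizeD m (p q : {poly K}) : (size p <= m)%N -> (size q <= m)%N -> (size (p + q)%R <= m)%N.
Proof. by move=> sp sq; rewrite (leq_trans (size_polyD _ _)) // geq_max sp. Qed.

Let sizeN m (p : {poly K}) : (size p <= m)%N -> (size (- p)%R <= m)%N.
Proof. by rewrite size_polyN. Qed.

Let sizeZ m z (p : {poly K}) : (size p <= m)%N -> (size (z *: p)%R <= m)%N.
Proof. exact: leq_trans (size_scale_leq _ _). Qed.

Let sizeMX m (p : {poly K}) : (size p <= m)%N -> (size (p * 'X)%R <= m.+1)%N.
Proof.
by move=> sp; rewrite (leq_trans (size_polyMleq _ _)) // size_polyX addn2.
Qed.

Let size_deriv m (p : {poly K}) : (size p <= m.+1)%N -> (size (deriv p) <= m)%N.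
Proof.
move=> sp; apply/leq_sizeP => i lemi; rewrite coef_deriv nth_default ?mul0rn //.
exact: leq_trans sp _.
Qed.

Let sizeYn n : (size (('X - b%:P) ^+ n)%R <= n.+1)%N.
Proof. by rewrite size_exp_XsubC. Qed.

Let sizeXn n : (size ('X^n : {poly K}) <= n.+1)%N.
Proof. by rewrite size_polyXn. Qed.

(** Both powers are monic; this cancellation keeps the entry (0, 1) of [orthS_pre n] at degree n. *)
Let size_XnBYn n : (size ('X^n - ('X - b%:P) ^+ n)%R <= n)%N.
Proof.
apply/leq_sizeP => i; rewrite leq_eqVlt => /predU1P[<-|ltni].
  have /monicP := monic_exp n (monicXsubC b).
  by rewrite lead_coefE size_exp_XsubC /= coefB => ->; rewrite coefXn eqxx subrr.
by rewrite nth_default // (leq_trans _ ltni) // sizeD // sizeN.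
Qed.

Let sizeYW n m : (n < m)%N -> (size (('X - b%:P) ^+ n)%R <= m)%N.
Proof. exact: leq_trans (sizeYn n). Qed.

Let sizeXW n m : (n < m)%N -> (size ('X^n : {poly K}) <= m)%N.
Proof. exact: leq_trans (sizeXn n). Qed.

Lemma size_orthS_pre n i j : (size (orthS_pre n i j) <= n.+1)%N.
Proof.
elim/forall3: i; elim/forall3: j; rewrite mxE /= ?size_poly0 //.
- apply/sizeZ/sizeD; first by rewrite -mulrBl; exact/sizeMX/size_XnBYn.
  exact/sizeN/sizeZ/size_deriv/sizeYW.
- exact/sizeZ/size_deriv/sizeXW.
- by apply/sizeZ/sizeYW; rewrite ltnS leq_pred.
- case: n => [|n]; first by rewrite !(mulr0, mul0r, scale0r, addr0) sizeXn.
  apply: sizeD; first apply: sizeD; first exact: sizeXn.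
    by apply/sizeZ/sizeD; [exact/sizeMX/sizeYn|apply/sizeZ/size_deriv/sizeYW; lia].
  by apply/sizeZ/sizeD; [exact/sizeMX/sizeXn|apply/sizeZ/size_deriv/sizeXW; lia].
- by apply/sizeZ/sizeXW; rewrite ltnS leq_pred.
Qed.

Lemma size_orthS n i j : (size (orthS a b c k n i j) <= n.+1)%N.
Proof. by rewrite orthS_preE mxE (leq_trans (size_hermT _)) // size_orthS_pre. Qed.

(** Up to exchanging two rows the leading matrix is upper triangular with diagonal 1, d, 1. Its
    entry [u] can stay unevaluated, since the matrix is invertible whatever its value. *)
Lemma lead_orthS n : 1 + (k * a ^+ 2 + c ^+ 2) * n%:R / 2 != 0 ->
  map_mx (coefp n) (orthS a b c k n) \in unitmx.
Proof.
set d := 1 + _ => d0.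
have coefS i j : map_mx (coefp n) (orthS a b c k n) i j = (orthS_pre n i j)`_n.
  by rewrite orthS_preE mxE [map_mx _ _ _ _]mxE; exact: (coef_hermT (size_orthS_pre n i j)).2.
pose u := (orthS_pre n 0 1)`_n.
have -> : map_mx (coefp n) (orthS a b c k n) = mx3 1 u 0 0 0 1 0 d 0.
  have lead_Y m : (('X - b%:P) ^+ m)`_m = 1.
    have /monicP := monic_exp m (monicXsubC b).
    by rewrite lead_coefE size_exp_XsubC.
  have lt_deriv (p : {poly K}) m : (size p <= m.+1)%N -> (deriv p)`_m = 0.
    by move=> /size_deriv sp; rewrite nth_default.
  apply/matrixP => i j; rewrite coefS /u; elim/forall3: i; elim/forall3: j;
    rewrite !mxE /= ?coef0 ?coefXn ?eqxx ?coefZ //.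
  - by rewrite lt_deriv ?sizeXn ?mulr0.
  - case: n @d d0 @u coefS => [|n] *; first by rewrite mulr0 !mul0r oppr0 mul0r.
    by rewrite [_`_n.+1]nth_default ?mulr0 // sizeYn.
  - rewrite /d; case: n @d d0 @u coefS => [|n] *.
      by rewrite !(mulr0, mul0r, scale0r, addr0) expr0 coef1.
    rewrite /= !coefD !coefZ !coefD !coefMX !coefZ /= lead_Y !coefXn !eqxx.
    by rewrite !lt_deriv ?sizeYW ?sizeXW //= !mulr0 !addr0 mulr1n; field.
  - case: n @d d0 @u coefS => [|n] *; first by rewrite mulr0 mul0r oppr0 mul0r.
    by rewrite [_`_n.+1]nth_default ?mulr0 // sizeXn.
have /mulmx1_unit[] // : mx3 1 u 0 0 0 1 0 d 0 *m mx3 1 0 (- u / d) 0 0 d^-1 0 1 0 = 1%:M.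
apply/matrixP => i j; rewrite mulmx3E.
by elim/forall3: i; elim/forall3: j; rewrite !mxE /=; field.
Qed.

End OrthSDegree.

(** * Gram matrices of the model rows, computed in the abstract *)

Section Gram.
Variables (K : numFieldType) (a b c k : K).

Definition model_coef n : 'M[K]_3 :=
  mx3 1 a 0
      0 c 1
      (- (k * a * n%:R / 2)) 1 (- (c * n%:R / 2)).

(** Where [model_coef] is zero the exponent n is only a filler. *)
Definition model_deg n : 'M[nat]_3 := \matrix_(i, j)
  nth 0%N (nth [::] [:: [:: n; n.+1; n]; [:: n; n.+1; n]; [:: n.-1; n; n.-1]] i) j.

Lemma model_factor n i : [/\
  model a b c k n i 0 = model_coef n i 0 *: ('X - b%:P) ^+ model_deg n i 0,
  model a b c k n i 1 = model_coef n i 1 *: 'X^(model_deg n i 1) &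
  model a b c k n i 2 = model_coef n i 2 *: 'X^(model_deg n i 2)].
Proof. by elim/forall3: i; rewrite !mxE /=; split; rewrite ?scale0r ?scale1r. Qed.

Definition gram n : 'M[K]_3 :=
  mx3 (1 + a ^+ 2 * k * n.+1%:R / 2) (a * c * k * n.+1%:R / 2) 0
      (a * c * k * n.+1%:R / 2) (k + c ^+ 2 * k * n.+1%:R / 2) 0
      0 0 (k * (1 + (k * a ^+ 2 + c ^+ 2) * n%:R / 2)).

(** Here h stands for the normalized inner products of Hermite polynomials, and l and k l for the
    masses of the Gaussians centred at b and 0. Between row 2 and the other rows the two
    contributions cancel on the diagonal of h, where the indices agree, and vanish off it. *)
Lemma gramE (h : nat -> nat -> K) l n m i j :
  (forall n m, h n.+1 m.+1 = n.+1%:R / 2 * h n m) ->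
  (forall n m, n != m -> h n m = 0) ->
  let u := model_coef n in let v := model_coef m in
  let d := model_deg n in let e := model_deg m in
  u i 0 * (v j 0 * (h (d i 0) (e j 0) * l)) +
   (u i 1 * (v j 1 * (h (d i 1) (e j 1) * (k * l))) +
    u i 2 * (v j 2 * (h (d i 2) (e j 2) * (k * l)))) =
  h n m * l * gram n i j.
Proof.
move=> hS h0 /=; elim/forall3: i; elim/forall3: j; rewrite !mxE /= ?hS.
- by field.
- by field.
- case: m => [|m]; first by rewrite (h0 n.+1 0%N) //; field.
  by rewrite /= hS; have [->|/h0 ->] := eqVneq n m; field.
- by field.
- by field.
- case: m => [|m]; first by rewrite (h0 n.+1 0%N) //; field.
  by rewrite /= hS; have [->|/h0 ->] := eqVneq n m; field.
- case: n => [|n]; first by rewrite (h0 0%N m.+1) //; field.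
  by rewrite /= hS; field.
- case: n => [|n]; first by rewrite (h0 0%N m.+1) //; field.
  by rewrite /= hS; field.
- case: n m => [|n] [|m]; rewrite ?(h0 0%N m.+1) ?(h0 n.+1 0%N) //=; try by field.
  by rewrite hS; have [->|/h0 ->] := eqVneq n m; field.
Qed.

(** The matrix is block diagonal, and its upper block has determinant k e; the inverse displayed in
    the proof is obtained from the adjugate. *)
Lemma gram_unit n : k != 0 -> 1 + (k * a ^+ 2 + c ^+ 2) * n%:R / 2 != 0 ->
  1 + (k * a ^+ 2 + c ^+ 2) * n.+1%:R / 2 != 0 -> gram n \in unitmx.
Proof.
move=> k0; rewrite /gram; set t := n.+1%:R; set d := 1 + _ => d0; set e := 1 + _ => e0.
have /mulmx1_unit[] // : gram n *m
  mx3 ((k + c ^+ 2 * k * t / 2) / (k * e)) (- (a * c * k * t / 2) / (k * e)) 0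
      (- (a * c * k * t / 2) / (k * e)) ((1 + a ^+ 2 * k * t / 2) / (k * e)) 0
      0 0 (k * d)^-1 = 1%:M.
rewrite /gram -/t -/d; clearbody d t.
have ee : e = 1 + (k * a ^+ 2 + c ^+ 2) * t / 2 by [].
apply/matrixP => i j; rewrite mulmx3E.
elim/forall3: i; elim/forall3: j; rewrite !mxE /= ?ee; try field; rewrite ?k0 ?d0 //=.
all: have -> : 2 + (k * a ^+ 2 + c ^+ 2) * t = 2 * e by rewrite ee; field.
all: by rewrite mulf_neq0 ?pnatr_eq0.
Qed.

End Gram.

(** * Realizing eigenvalues by elements of the module *)

Section Spectral.
Variables (K : numFieldType) (a b c k : K).
Hypothesis c0 : c != 0.
Implicit Types (D E : diffop K 2) (p q : {poly K}).

Lemma map_hermT_mull (G : 'M[K]_3) (U : 'M[{poly K}]_3) :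
  map_mx (@hermT K) (map_mx polyC G *m U) = map_mx polyC G *m map_mx (@hermT K) U.
Proof.
apply/matrixP => i j; rewrite mxE !mulmx3E ![map_mx _ _ _ _]mxE !mul_polyC.
by rewrite !hermTD !hermTZ.
Qed.

Local Notation S := (orthS a b c k).

Lemma dact_orthS_gD1 n : dact (S n) (gD1 a b c) = map_mx polyC (eigen1 K n) *m S n.
Proof. by rewrite /orthS dact_gD1 model_eigen1 map_hermT_mull mulmxA. Qed.

Lemma dact_orthS_gD2 n : dact (S n) (gD2 a c) = map_mx polyC (eigen2 a c n) *m S n.
Proof. by rewrite /orthS dact_gD2 // model_eigen2 // map_hermT_mull mulmxA. Qed.

Definition eigenpoly p n : 'M[K]_3 :=
  let x := p.[- 2 * n%:R] in mx3 x 0 0 0 x 0 0 0 p.[2 - 2 * n%:R].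

Lemma dact_orthS_horner p n :
  dact (S n) (horner_alg (gD1 a b c) p) = map_mx polyC (eigenpoly p n) *m S n.
Proof.
elim/poly_ind: p => [|p z IH].
  rewrite rmorph0 dact0 (_ : eigenpoly 0 n = 0) ?map_mx0 ?mul0mx //.
  by apply/matrixP => i j; elim/forall3: i; elim/forall3: j; rewrite !mxE /= ?horner0.
rewrite rmorphD rmorphM /= horner_algX horner_algC dactD dact_mul IH dact_mull.
rewrite dact_orthS_gD1 dact_scale dact1 mulmxA -mul_scalar_mx -mulmxDl -map_mxM.
rewrite -map_scalar_mx -map_mxD; congr (map_mx _ _ *m _).
apply/matrixP => i j; rewrite mxE mulmx3E.
by elim/forall3: i; elim/forall3: j; rewrite !mxE /= ?hornerMXaddC; ring.
Qed.

Lemma dact_orthS_module p q n :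
  dact (S n) (horner_alg (gD1 a b c) p * 1 + horner_alg (gD1 a b c) q * gD2 a c) =
  map_mx polyC (eigenpoly p n + eigenpoly q n *m eigen2 a c n) *m S n.
Proof.
rewrite mulr1 dactD dact_mul !dact_orthS_horner dact_mull dact_orthS_gD2.
by rewrite mulmxA -map_mxM -mulmxDl -map_mxD.
Qed.

Hypotheses (a0 : a != 0) (b0 : b != 0) (k0 : k != 0).

(** The polynomials p and q are chosen so that the difference of the two operators has zero
    eigenvalue matrices from index 2 on; [model_annihilator] then makes it zero. *)
Lemma module_of_eigen D (G : nat -> 'M[K]_3) :
  (forall n, dact (S n) D = map_mx polyC (G n) *m S n) ->
  exists p q, D = horner_alg (gD1 a b c) p * 1 + horner_alg (gD1 a b c) q * gD2 a c.
Proof.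
move=> DG; have [phi [phiG _]] := straighten_model DG.
have [A [Q GE]] := model_eigenvalues a0 b0 c0 k0 phiG.
(* The substitution x |-> -x/2 undoes the eigenvalue -2n. Entry (0, 1) of the eigenvalue matrices
   fixes q, after which entry (0, 0) fixes p. *)
pose r (p : {poly K}) := p \Po (- 2^-1 *: 'X).
pose q := - (c ^+ 2 / 4) *: r Q; pose p := r A - (2 + 4 / c ^+ 2) *: q.
exists p, q; set E := (X in _ = X); apply/eqP; rewrite -subr_eq0; apply/eqP.
pose G' n := G n - (eigenpoly p n + eigenpoly q n *m eigen2 a c n).
have EG n : dact (S n) (D - E) = map_mx polyC (G' n) *m S n.
  apply: (addIr (dact (S n) E)); rewrite -dactD subrK DG dact_orthS_module.
  by rewrite -mulmxDl -map_mxD subrK.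
have [phi' [phiG' ->//]] := straighten_model EG.
move=> l j; apply: (model_annihilator a0 b0 phiG' (N := 2)) => -[|[|n]] // _ {l j}.
rewrite /G' GE; apply/matrixP => i j'; rewrite !mxE sum3E.
have rE s x : (r s).[x] = s.[- x / 2].
  by rewrite horner_comp hornerZ hornerX; congr (s.[_]); field.
have e0 : - (- 2 * n.+2%:R) / 2 = n.+2%:R :> K by field.
have e2 : - (2 - 2 * n.+2%:R) / 2 = n.+1%:R :> K by field.
elim/forall3: i; elim/forall3: j'; rewrite !mxE /= ?(hornerD, hornerN, hornerZ, rE).
all: by rewrite ?e0 ?e2; field; rewrite ?c0.
Qed.

End Spectral.

(** * Gaussian integrals *)

Import numFieldNormedType.Exports.

Section GaussianIntegrals.
Local Open Scope classical_set_scope.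
Variable R : realType.
Implicit Types (p q : {poly R}) (t x : R).
Local Notation mu := (@lebesgue_measure R).

(** The Gaussian e^(-(x - t)^2) multiplied by e^(t^2). *)
Definition gw t x : R := expR (- x ^+ 2 + 2 * t * x).

Lemma horner_exp_bound p :
  exists C (k : nat), 0 <= C /\ forall x, `|p.[x]| <= C * expR (k%:R * `|x|).
Proof.
elim/poly_ind: p => [|p c [C [k [C0 IH]]]].
  by exists 0, 0%N; split=> // x; rewrite horner0 normr0 mul0r.
exists (C + `|c|), k.+1; split=> [|x]; first exact: addr_ge0.
rewrite hornerMXaddC mulrDl.
have e1 y : 1 <= expR `|y| :> R by rewrite -expR0 ler_expR.
have le1 : 1 <= expR (k.+1%:R * `|x|) :> R.
  by rewrite -expR0 ler_expR mulr_ge0.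
apply: le_trans (ler_normD _ _) _; apply: lerD; last exact: ler_peMr.
rewrite normrM -addn1 natrD mulrDl mul1r expRD mulrA.
apply: ler_pM => //; apply: le_trans (expR_ge1Dx _); lra.
Qed.

Lemma gw_bound t p : exists C, 0 <= C /\
  forall x, `|p.[x] * gw t x| <= C * expR (- (x ^+ 2) / 2).
Proof.
have [C [k [C0 le_p]]] := horner_exp_bound p.
pose u : R := k%:R + 2 * `|t|.
(* From (u - |x|)^2 >= 0, the linear growth u |x| is at most u^2/2 + x^2/2, which leaves half of the
   Gaussian decay. *)
exists (C * expR (u ^+ 2 / 2)); split=> [|x].
  by rewrite mulr_ge0 ?expR_ge0.
rewrite normrM [`|gw t x|]ger0_norm ?expR_ge0 //.
apply: le_trans (ler_wpM2r (expR_ge0 _) (le_p x)) _.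
rewrite -!mulrA; apply: ler_wpM2l => //; rewrite -!expRD ler_expR.
have le1 : t * x <= `|t| * `|x| by rewrite -normrM ler_norm.
have -> : x ^+ 2 = `|x| ^+ 2 by rewrite real_normK ?num_real.
have := sqr_ge0 (u - `|x|); rewrite /u; nra.
Qed.

Lemma continuous_pgw t p : continuous (fun x => p.[x] * gw t x).
Proof.
move=> x; apply: cvgM; first exact: continuous_horner.
apply: continuous_comp; last exact: continuous_expR.
apply: cvgD; first by apply: cvgN; exact: exprn_continuous.
apply: cvgM; [exact: cvg_cst|exact: cvg_id].
Qed.

Lemma measurable_pgw t p : measurable_fun setT (fun x => p.[x] * gw t x).
Proof.
apply: (@measurable_realfun.continuous_measurable_fun R).
exact: continuous_pgw.
Qed.

Lemma integrable_normal01 : mu.-integrable setT (fun x => (expR (- (x ^+ 2) / 2))%:E).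
Proof.
have s0 : (1 : R) != 0 by exact: oner_neq0.
have := integrable_normal_pdf (0 : R) 1.
move=> /(integrableZl measurableT (normal_peak 1)^-1).
apply: eq_integrable => // x _ /=.
rewrite normal_pdfE // -EFinM /normal_fun subr0 mulrA mulVf ?mul1r; last first.
  by rewrite gt_eqF // normal_peak_gt0.
by rewrite expr1n.
Qed.

Lemma integrable_pgw t p : mu.-integrable setT (fun x => (p.[x] * gw t x)%:E).
Proof.
have [C [C0 le_p]] := gw_bound t p.
have := integrableZl measurableT C integrable_normal01.
apply: le_integrable => //.
  by apply/measurable_EFinP; exact: measurable_pgw.
move=> x _ /=; rewrite lee_fin (le_trans (le_p x)) // ler_norm //.
Qed.


Lemma is_derive_pgw t p x :
  is_derive x 1 (fun y => p.[y] * gw t y)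
    ((p^`() - 2 *: (('X - t%:P) * p)).[x] * gw t x).
Proof.
have dg : is_derive x 1 (fun y : R => - y ^+ 2 + 2 * t * y) (- (2 * x) + 2 * t).
  by apply: trigger_derive; rewrite /GRing.scale /= !mulr1; ring.
have de := @is_derive1_comp R expR _ x _ _ (is_derive_expR _) dg.
have dp := is_deriveM (is_derive_poly p x) de.
apply: (is_derive_eq dp); rewrite /gw /= /GRing.scale /= !hornerE /=; ring.
Qed.

Lemma cvg_expRN_natr : (fun n => expR (- (n.+1%:R ^+ 2) / 2)) @ \oo --> (0 : R).
Proof.
(* With m = n+1, m/2 <= 1 + m^2/2 <= e^(m^2/2) gives the upper bound 2/m. *)
apply: (@squeeze_cvgr _ _ _ _ (cst 0) (fun n => 2 * @harmonic R n)).
- near=> n; rewrite expR_ge0 /= mulNr expRN /=.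
  rewrite -[X in _ <= X]invrK lef_pV2 ?posrE ?invr_gt0 ?mulr_gt0 ?expR_gt0 //.
  rewrite invfM invrK; apply: le_trans (expR_ge1Dx _).
  have := sqr_ge0 (n.+1%:R - 1 : R); nra.
- exact: cvg_cst.
- by rewrite -[X in _ --> X](mulr0 2); apply: cvgM; [exact: cvg_cst|exact: cvg_harmonic].
Unshelve. all: by end_near. Qed.

(** Stating the hypothesis on squares covers both endpoints n+1 and -(n+1). *)
Lemma cvg_pgw t p (u : R^nat) : (forall n, u n ^+ 2 = n.+1%:R ^+ 2) ->
  (fun n => p.[u n] * gw t (u n)) @ \oo --> (0 : R).
Proof.
move=> u2; have [C [C0 le_p]] := gw_bound t p.
apply/norm_cvg0P.
apply: (@squeeze_cvgr _ _ _ _ (cst 0) (fun n => C * expR (- (n.+1%:R ^+ 2) / 2))).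
- by apply: nearW => n; rewrite normr_ge0 /= -u2 le_p.
- exact: cvg_cst.
- by rewrite -[X in _ --> X](mulr0 C); apply: cvgM; [exact: cvg_cst|exact: cvg_expRN_natr].
Qed.

Lemma integral_deriv_pgw_itv t p (n : nat) (q := p^`() - 2 *: (('X - t%:P) * p)) :
  (\int[mu]_(x in `[(- n.+1%:R)%R, n.+1%:R]) (q.[x] * gw t x)%:E =
   (p.[n.+1%:R] * gw t n.+1%:R)%:E - (p.[- n.+1%:R] * gw t (- n.+1%:R))%:E)%E.
Proof.
pose F x := p.[x] * gw t x.
have cF := @continuous_pgw t p.
rewrite (@continuous_FTC2 R (fun x => q.[x] * gw t x) F) //.
- by rewrite ltrNl (lt_trans (y := 0)) // ?oppr_lt0 ltr0n.
- exact/continuous_subspaceT/continuous_pgw.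
- split=> [x _||].
  + by have [] := is_derive_pgw t p x.
  + exact/cvg_at_right_filter/cF.
  + exact/cvg_at_left_filter/cF.
- by move=> x _; rewrite derive1E; have [] := is_derive_pgw t p x.
Qed.

(** The integrand is the derivative of p times the Gaussian. Its integrals over [-(n+1), n+1] tend
    to the full integral by dominated convergence, and to 0 because the boundary terms decay. *)
Lemma Rintegral_deriv_pgw t p :
  \int[mu]_x ((p^`() - 2 *: (('X - t%:P) * p)).[x] * gw t x) = 0.
Proof.
set q := _ - _; pose f x := q.[x] * gw t x.
pose I n : set R := `[(- n.+1%:R)%R, n.+1%:R]%classic.
have intf := @integrable_pgw t q.
have mf : measurable_fun setT (EFin \o f).
  by apply/measurable_EFinP; exact: measurable_pgw.
have [] := @dominated_convergence _ _ R mu setT measurableT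
  (fun n => (EFin \o f) \_ (I n)) (EFin \o f) (fun x => `|(f x)%:E|%E).
- move=> n; apply: (measurable_restrictT (EFin \o f) (_ : measurable (I n))).1.
    exact: measurable_itv.
  exact: measurable_funS mf.
- exact: mf.
- apply/aeW => x _; apply: cvg_near_cst; near=> n.
  rewrite patchE ifT // inE /I /= in_itv /= -ler_norml.
  by rewrite (le_trans (y := n%:R)) ?ler_nat //; near: n; exact: nbhs_infty_ger.
- exact: integrable_abse intf.
- apply/aeW => x n _; rewrite patchE; case: ifP => // _; by rewrite abse0.
move=> _ _ cvg_int; rewrite /Rintegral.
have lim0 : (fun n => \int[mu]_x ((EFin \o f) \_ (I n)) x)%E @ \oo --> 0%E.
  have -> : (fun n => \int[mu]_x ((EFin \o f) \_ (I n)) x)%E =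
     (fun n => (p.[n.+1%:R] * gw t n.+1%:R - p.[- n.+1%:R] * gw t (- n.+1%:R))%:E).
    by apply/funext => n; rewrite -integral_mkcond integral_deriv_pgw_itv EFinB.
  apply: cvg_EFin; first exact: nearW.
  rewrite -[X in _ --> X](subr0 0); apply: cvgB; apply: cvg_pgw => n //.
  by rewrite sqrrN.
by rewrite (cvg_unique _ cvg_int lim0).
Unshelve. all: by end_near. Qed.

Lemma Rintegral_gw_gt0 t : 0 < \int[mu]_x (gw t x).
Proof.
(* The standard deviation for which 2 s^2 = 1, so that [gw t] is a multiple of the normal density of
   mean t. *)
pose s : R := (Num.sqrt 2)^-1.
have s0 : s != 0 by rewrite invr_eq0 sqrtr_eq0 -ltNge ltr0n.
have peak0 := normal_peak_gt0 s0.
suff -> : \int[mu]_x (gw t x) = expR (t ^+ 2) / normal_peak s.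
  by rewrite divr_gt0 ?expR_gt0.
transitivity (\int[mu]_x (expR (t ^+ 2) / normal_peak s * normal_pdf t s x)).
  apply: eq_Rintegral => x _; rewrite normal_pdfE // mulrA divfK ?gt_eqF //.
  rewrite /normal_fun -expRD /gw; congr expR.
  have -> : s ^+ 2 *+ 2 = 1 by rewrite /s exprVn sqr_sqrtr ?ler0n // -mulr_natr mulVf ?pnatr_eq0.
  by rewrite divr1; ring.
rewrite RintegralZl //; last exact: integrable_normal_pdf.
by rewrite /Rintegral integral_normal_pdf mulr1.
Qed.

End GaussianIntegrals.

(** * Gaussian moments of complex polynomials *)

Section ComplexMoments.
Local Open Scope complex_scope.
Local Open Scope classical_set_scope.
Local Open Scope sesquilinear_scope.
Variable R : realType.
Local Notation C := R[i].
Local Notation mu := (@lebesgue_measure R).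
Implicit Types (p q : {poly C}) (t x : R) (z : C).

Lemma complex_ReD z z' : complex.Re (z + z') = complex.Re z + complex.Re z'.
Proof. by case: z z' => [? ?] []. Qed.

Lemma complex_ImD z z' : complex.Im (z + z') = complex.Im z + complex.Im z'.
Proof. by case: z z' => [? ?] []. Qed.

Lemma complex_ReMC z t : complex.Re (z * t%:C) = complex.Re z * t.
Proof. by case: z => u v /=; rewrite mulr0 subr0. Qed.

Lemma complex_ImMC z t : complex.Im (z * t%:C) = complex.Im z * t.
Proof. by case: z => u v /=; rewrite mulr0 add0r. Qed.

Definition repoly p : {poly R} := map_poly (@complex.Re R) p.
Definition impoly p : {poly R} := map_poly (@complex.Im R) p.

Lemma coef_repoly p i : (repoly p)`_i = complex.Re p`_i.
Proof. exact: coef_map_id0. Qed.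

Lemma coef_impoly p i : (impoly p)`_i = complex.Im p`_i.
Proof. exact: coef_map_id0. Qed.

Lemma repolyD p q : repoly (p + q) = repoly p + repoly q.
Proof. by apply/polyP => i; rewrite !(coef_repoly, coefD) complex_ReD. Qed.

Lemma impolyD p q : impoly (p + q) = impoly p + impoly q.
Proof. by apply/polyP => i; rewrite !(coef_impoly, coefD) complex_ImD. Qed.

Lemma repolyC z : repoly z%:P = (complex.Re z)%:P.
Proof. by apply/polyP => i; rewrite coef_repoly !coefC; case: eqP. Qed.

Lemma impolyC z : impoly z%:P = (complex.Im z)%:P.
Proof. by apply/polyP => i; rewrite coef_impoly !coefC; case: eqP. Qed.

Lemma repolyMX p : repoly (p * 'X) = repoly p * 'X.
Proof. by apply/polyP => i; rewrite !(coef_repoly, coefMX); case: eqP. Qed.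

Lemma impolyMX p : impoly (p * 'X) = impoly p * 'X.
Proof. by apply/polyP => i; rewrite !(coef_impoly, coefMX); case: eqP. Qed.

Lemma horner_repoly p x : (repoly p).[x] = complex.Re p.[x%:C].
Proof.
elim/poly_ind: p => [|p c IH]; first by rewrite /repoly map_poly0 !horner0.
by rewrite repolyD repolyMX repolyC !hornerMXaddC complex_ReD complex_ReMC IH.
Qed.

Lemma horner_impoly p x : (impoly p).[x] = complex.Im p.[x%:C].
Proof.
elim/poly_ind: p => [|p c IH]; first by rewrite /impoly map_poly0 !horner0.
by rewrite impolyD impolyMX impolyC !hornerMXaddC complex_ImD complex_ImMC IH.
Qed.

Definition gint t p : C := cintegral (fun x => p.[x%:C] * (gw t x)%:C).

Let M t (p : {poly R}) : R := \int[mu]_x (p.[x] * gw t x).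

Let MD t (p q : {poly R}) : M t (p + q) = M t p + M t q.
Proof.
rewrite /M -RintegralD //; try exact: integrable_pgw.
by apply: eq_Rintegral => x _; rewrite hornerD mulrDl.
Qed.

Let MZ t (k : R) (p : {poly R}) : M t (k *: p) = k * M t p.
Proof.
rewrite /M -RintegralZl //; last exact: integrable_pgw.
by apply: eq_Rintegral => x _; rewrite hornerZ mulrA.
Qed.

Let gintE t p : gint t p = M t (repoly p) +i* M t (impoly p).
Proof.
rewrite /gint /cintegral; congr (_ +i* _); apply: eq_Rintegral => x _.
  by rewrite complex_ReMC horner_repoly.
by rewrite complex_ImMC horner_impoly.
Qed.

Lemma gintD t p q : gint t (p + q) = gint t p + gint t q.
Proof. by rewrite !gintE repolyD impolyD !MD. Qed.

Lemma gintZ t z p : gint t (z *: p) = z * gint t p.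
Proof.
rewrite !gintE; case: z => u v.
have -> : repoly ((u +i* v) *: p) = u *: repoly p + (- v) *: impoly p.
  apply/polyP => i; rewrite coefD !coefZ coef_impoly !coef_repoly coefZ.
  by case: (p`_i) => y y' /=; rewrite mulNr.
have -> : impoly ((u +i* v) *: p) = u *: impoly p + v *: repoly p.
  apply/polyP => i; rewrite coefD !coefZ coef_repoly !coef_impoly coefZ.
  by case: (p`_i).
by rewrite !MD !MZ mulNr.
Qed.

Let repolyZ (k : R) p : repoly (k%:C *: p) = k *: repoly p.
Proof.
by apply/polyP => i; rewrite coefZ !coef_repoly coefZ mulrC complex_ReMC mulrC.
Qed.

Let impolyZ (k : R) p : impoly (k%:C *: p) = k *: impoly p.
Proof.
by apply/polyP => i; rewrite coefZ !coef_impoly coefZ mulrC complex_ImMC mulrC.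
Qed.

Let repoly_deriv p : repoly (deriv p) = deriv (repoly p).
Proof.
elim/poly_ind: p => [|p c IH]; first by rewrite deriv0 /repoly map_poly0 deriv0.
by rewrite repolyD repolyMX repolyC !derivMXaddC repolyD repolyMX IH.
Qed.

Let impoly_deriv p : impoly (deriv p) = deriv (impoly p).
Proof.
elim/poly_ind: p => [|p c IH]; first by rewrite deriv0 /impoly map_poly0 deriv0.
by rewrite impolyD impolyMX impolyC !derivMXaddC impolyD impolyMX IH.
Qed.

(** The first-order operator has real coefficients, hence commutes with taking real and imaginary
    parts, and the real case applies to each. *)
Lemma gint_deriv t p : gint t (p^`() - 2 *: (('X - t%:C%:P) * p)) = 0.
Proof.
have split_deriv (K : comNzRingType) (s : K) (q : {poly K}) :
    q^`() - 2 *: (('X - s%:P) * q) = q^`() + (- 2) *: (q * 'X) + (2 * s) *: q.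
  by rewrite -!mul_polyC polyCN polyCM !polyC_natr; ring.
have -> : p^`() - 2 *: (('X - t%:C%:P) * p) =
    p^`() + (- 2)%:C *: (p * 'X) + (2 * t)%:C *: p.
  by rewrite split_deriv !(rmorphN, rmorphM, rmorph_nat).
rewrite gintE !(repolyD, impolyD, repolyZ, impolyZ, repolyMX, impolyMX).
rewrite repoly_deriv impoly_deriv -!split_deriv.
by rewrite /M !Rintegral_deriv_pgw.
Qed.

Lemma gint1 t : gint t 1 = (\int[mu]_x gw t x)%:C.
Proof.
rewrite gintE -polyC1 repolyC impolyC /=; congr (_ +i* _).
  by apply: eq_Rintegral => x _; rewrite hornerC mul1r.
rewrite /M; under eq_Rintegral do rewrite horner0 mul0r.
by rewrite Rintegral_cst //= mul0r.
Qed.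

Lemma cintegral_gw2 t s p q :
  cintegral (fun x => p.[x%:C] * (gw t x)%:C + q.[x%:C] * (gw s x)%:C) =
  gint t p + gint s q.
Proof.
rewrite !gintE /cintegral /M; apply/eqP; rewrite eq_complex /=; apply/andP; split.
- rewrite -RintegralD //; try exact: integrable_pgw.
  apply/eqP/eq_Rintegral => x _.
  by rewrite complex_ReD !complex_ReMC !horner_repoly.
- rewrite -RintegralD //; try exact: integrable_pgw.
  apply/eqP/eq_Rintegral => x _.
  by rewrite complex_ImD !complex_ImMC !horner_impoly.
Qed.

End ComplexMoments.

(** * Orthogonality *)

Section InnerProduct.
Local Open Scope complex_scope.
Local Open Scope sesquilinear_scope.
Variables (R : realType) (a b c : R).
Local Notation C := R[i].
Local Notation MP := 'M[{poly C}]_3.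
Local Notation aC := (a%:C).
Local Notation bC := (b%:C).
Local Notation cC := (c%:C).
Implicit Types (p q : {poly C}) (t : R) (P Q U V : MP).

Definition conjp p : {poly C} := map_poly Num.conj p.

Lemma conj_realC t : Num.conj t%:C = t%:C :> C.
Proof. by rewrite conj_Creal // complex_real. Qed.

Lemma horner_conjp p t : (conjp p).[t%:C] = Num.conj p.[t%:C].
Proof. by rewrite -{1}conj_realC horner_map. Qed.

Lemma gint0 t : gint t (0 : {poly C}) = 0.
Proof. by have := gintZ t 0 (0 : {poly C}); rewrite !scale0r mul0r. Qed.

Lemma straightE (P : MP) i : [/\ (P *m straight aC cC) i 0 = P i 0,
  (P *m straight aC cC) i 1 = aC%:P * 'X * P i 0 + P i 1 + cC%:P * 'X * P i 2
  & (P *m straight aC cC) i 2 = P i 2].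
Proof. by rewrite !mulmx3E ![straight _ _ _ _]mxE /=; split; ring. Qed.

Definition winner U V i j : C :=
  gint b (U i 0 * conjp (V j 0)) +
  (gint 0 (U i 1 * conjp (V j 1)) + gint 0 (U i 2 * conjp (V j 2))).

(** The factorization of [W] through [straight] makes the weight diagonal, so the entry is a sum of
    three scalar Gaussian moments. *)
Lemma innerE P Q i j : inner (W a b c) P Q i j =
  winner (P *m straight aC cC) (Q *m straight aC cC) i j.
Proof.
rewrite mxE /winner -gintD -cintegral_gw2; congr cintegral; apply/funext => x.
have [-> -> ->] := straightE P i; have [-> -> ->] := straightE Q j.
rewrite [LHS]mulmx3E ![(_ *m W _ _ _ _) _ _]mulmx3E ![(_ ^t*) _ _]mxE !(mxE) /=.
have -> : gw b x = expR (- x ^+ 2) * expR (2 * b * x) by rewrite /gw expRD.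
have -> : gw 0 x = expR (- x ^+ 2) by rewrite /gw mulr0 mul0r addr0.
rewrite !(hornerM, hornerD, horner_conjp, hornerC, hornerX).
rewrite !(rmorphM, rmorphD, rmorph1, rmorphXn) /= !conj_realC.
ring.
Qed.

Let mxD (T : nmodType) (A B : 'M[T]_3) i j : (A + B) i j = A i j + B i j.
Proof. by rewrite mxE. Qed.

Let sum3D (V : nmodType) (x x' y y' z z' : V) :
  (x + x') + ((y + y') + (z + z')) = (x + (y + z)) + (x' + (y' + z')).
Proof. by rewrite [X in _ + X]addrACA addrACA. Qed.

Lemma winner_addl U U' V i j : winner (U + U') V i j = winner U V i j + winner U' V i j.
Proof. by rewrite /winner !mxD !mulrDl !gintD sum3D. Qed.

Lemma winner_addr U V V' i j : winner U (V + V') i j = winner U V i j + winner U V' i j.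
Proof. by rewrite /winner !mxD /conjp !rmorphD /= !mulrDr !gintD sum3D. Qed.

Let mxM (G : 'M[C]_3) U i j : (map_mx polyC G *m U) i j = \sum_l G i l *: U l j.
Proof. by rewrite mxE; apply: eq_bigr => l _; rewrite mxE mul_polyC. Qed.

Let gint_suml t q (u : 'I_3 -> C) (p : 'I_3 -> {poly C}) :
  gint t ((\sum_l u l *: p l) * q) = \sum_l u l * gint t (p l * q).
Proof. by rewrite !sum3E !mulrDl -!scalerAl !gintD !gintZ. Qed.

Let gint_sumr t q (u : 'I_3 -> C) (p : 'I_3 -> {poly C}) :
  gint t (q * conjp (\sum_l u l *: p l)) =
  \sum_l Num.conj (u l) * gint t (q * conjp (p l)).
Proof.
have conjpZ z r : conjp (z *: r) = Num.conj z *: conjp r.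
  by rewrite -!mul_polyC /conjp rmorphM /= map_polyC.
have conjpD r r' : conjp (r + r') = conjp r + conjp r' by rewrite /conjp rmorphD.
by rewrite !sum3E !conjpD !conjpZ !mulrDr -!scalerAr !gintD !gintZ.
Qed.

Lemma winner_mull (G : 'M[C]_3) U V i j :
  winner (map_mx polyC G *m U) V i j = \sum_l G i l * winner U V l j.
Proof.
rewrite /winner (mxM G U i 0) (mxM G U i 1) (mxM G U i 2).
rewrite (gint_suml b _ (G i) (fun l => U l 0)) (gint_suml 0 _ (G i) (fun l => U l 1)).
rewrite (gint_suml 0 _ (G i) (fun l => U l 2)).
under [RHS]eq_bigr do rewrite !mulrDr.
by rewrite big_split; congr (_ + _); rewrite big_split.
Qed.

Lemma winner_mulr (G : 'M[C]_3) U V i j :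
  winner U (map_mx polyC G *m V) i j = \sum_l Num.conj (G j l) * winner U V i l.
Proof.
rewrite /winner (mxM G V j 0) (mxM G V j 1) (mxM G V j 2).
rewrite (gint_sumr b _ (G j) (fun l => V l 0)) (gint_sumr 0 _ (G j) (fun l => V l 1)).
rewrite (gint_sumr 0 _ (G j) (fun l => V l 2)).
under [RHS]eq_bigr do rewrite !mulrDr.
by rewrite big_split; congr (_ + _); rewrite big_split.
Qed.

Lemma inner_addl P P' Q :
  inner (W a b c) (P + P') Q = inner (W a b c) P Q + inner (W a b c) P' Q.
Proof.
apply/matrixP => i j.
rewrite innerE.
rewrite mulmxDl winner_addl.
by rewrite [RHS]mxE; congr (_ + _); rewrite innerE.
Qed.

Lemma inner_addr P Q Q' :
  inner (W a b c) P (Q + Q') = inner (W a b c) P Q + inner (W a b c) P Q'.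
Proof.
apply/matrixP => i j.
rewrite innerE.
rewrite mulmxDl winner_addr.
by rewrite [RHS]mxE; congr (_ + _); rewrite innerE.
Qed.

Lemma inner_mull (G : 'M[C]_3) P Q :
  inner (W a b c) (map_mx polyC G *m P) Q = G *m inner (W a b c) P Q.
Proof.
apply/matrixP => i j; rewrite (innerE (_ *m P)) -mulmxA winner_mull [RHS]mxE.
by apply: eq_bigr => l _; rewrite (innerE P).
Qed.

Lemma inner_mulr (G : 'M[C]_3) P Q :
  inner (W a b c) P (map_mx polyC G *m Q) = inner (W a b c) P Q *m G^t*.
Proof.
apply/matrixP => i j; rewrite (innerE _ (_ *m Q)) -mulmxA winner_mulr [RHS]mxE.
apply: eq_bigr => l _; rewrite (innerE P) mulrC; congr (_ * _).
by rewrite !mxE.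
Qed.

End InnerProduct.

(** * Orthogonality of the scalar Hermite polynomials *)

Section HermiteOrthogonality.
Local Open Scope complex_scope.
Local Open Scope sesquilinear_scope.
Variable R : realType.
Local Notation C := R[i].
Implicit Types (p q : {poly C}) (t : R).

Definition hermY t n : {poly C} := hermT (('X - t%:C%:P) ^+ n).

Lemma hermY_S t n : hermY t n.+1 = hermY t n * ('X - t%:C%:P) - 2^-1 *: deriv (hermY t n).
Proof. by rewrite /hermY exprSr hermT_MXsubC. Qed.

Lemma conjp_hermY t n : conjp (hermY t n) = hermY t n.
Proof.
elim: n => [|n IH].
  by rewrite /hermY expr0 -polyC1 hermTC /conjp map_polyC /= conjC1.
rewrite hermY_S /conjp rmorphB rmorphM /= -!mul_polyC rmorphM /= map_polyC /= -deriv_map.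
rewrite -/(conjp _) IH rmorphB /= map_polyX map_polyC /= conj_realC.
by rewrite fmorphV rmorph_nat.
Qed.

(** Integration by parts: the difference of the sides is a multiple of [gint_deriv] at the product
    of [hermY t n] and q. *)
Lemma gint_hermY_raise t n q :
  gint t (hermY t n.+1 * q) = 2^-1 * gint t (hermY t n * deriv q).
Proof.
apply/eqP; rewrite -subr_eq0 -gintZ -[- gint _ _]mulN1r -gintZ -gintD.
have -> : hermY t n.+1 * q + -1 *: (2^-1 *: (hermY t n * deriv q)) =
  - 2^-1 *: (deriv (hermY t n * q) - 2 *: (('X - t%:C%:P) * (hermY t n * q))).
  have half : 2 * (2^-1)%:P = 1 :> {poly C}.
    by rewrite -polyC_natr -polyCM divff // pnatr_eq0.
  rewrite hermY_S derivM -!mul_polyC !(polyCN, polyC_natr).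
  move: (hermY t n) (deriv (hermY t n)) ('X - _) (deriv q) ((2^-1)%:P) half => h h' x q' e half.
  by ring: half.
by rewrite gintZ gint_deriv mulr0.
Qed.

Lemma gint_hermY t n q : gint t (hermY t n * q) = 2^-1 ^+ n * gint t (derivn n q).
Proof.
elim: n q => [|n IH] q.
  by rewrite expr0 mul1r derivn0 /hermY expr0 -polyC1 hermTC mul1r.
by rewrite gint_hermY_raise IH exprS mulrA derivSn.
Qed.

Definition hnorm n m : C := (n == m)%:R * (n`!%:R * 2^-1 ^+ n).

(** By symmetry m <= n. Moving n derivatives onto the second factor gives 0 when m < n, and n! when
    m = n since that factor is monic. *)
Lemma gint_hermY2 t n m : gint t (hermY t n * hermY t m) = hnorm n m * gint t 1.
Proof.
wlog lemn : n m / (m <= n)%N.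
  move=> wl; have [/wl//|/ltnW/wl] := leqP m n.
  rewrite mulrC => ->; rewrite /hnorm eq_sym; case: eqP => [->|]; by rewrite ?mul0r.
have [sH H1] : (size (hermY t m) <= m.+1)%N /\ (hermY t m)`_m = 1.
  have sY : (size (('X - t%:C%:P) ^+ m) <= m.+1)%N by rewrite size_exp_XsubC.
  have [sH H1] := coef_hermT sY; split; first exact: sH.
  have /monicP := monic_exp m (monicXsubC t%:C).
  by rewrite lead_coefE size_exp_XsubC /= -H1.
rewrite gint_hermY; move: (hermY t m) sH H1 => h sH H1.
move: lemn; rewrite /hnorm leq_eqVlt => /predU1P[mn|ltmn].
  rewrite -mn eqxx (derivn_lead sH) H1 mulr1 mul1r.
  by rewrite -[(_)%:P]mulr1 mul_polyC gintZ mulrA [2^-1 ^+ m * _]mulrC.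
have -> : (n == m) = false by rewrite gtn_eqF.
have -> : derivn n h = 0 by apply: derivn_poly0; apply: leq_trans sH ltmn.
by rewrite gint0 mulr0 !mul0r.
Qed.

Lemma hnormS n m : hnorm n.+1 m.+1 = n.+1%:R / 2 * hnorm n m.
Proof. by rewrite /hnorm eqSS factS natrM exprS; ring. Qed.

Lemma hnorm_gt0 n : 0 < hnorm n n.
Proof. by rewrite /hnorm eqxx mul1r mulr_gt0 ?exprn_gt0 ?invr_gt0 ?ltr0n ?fact_gt0. Qed.

End HermiteOrthogonality.

(** * An explicit sequence of orthogonal polynomials for [W] *)

Section OrthogonalSequence.
Local Open Scope complex_scope.
Local Open Scope sesquilinear_scope.
Variables (R : realType) (a b c : R).
Local Notation C := R[i].
Local Notation MP := 'M[{poly C}]_3.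
Local Notation mu := (@lebesgue_measure R).

(** Its value is e^(-b^2); as a ratio of masses it makes [gint1_kap] immediate. *)
Definition kapR : R := (\int[mu]_x gw 0 x) / (\int[mu]_x gw b x).
Definition kap : C := kapR%:C.

Lemma kapR_gt0 : 0 < kapR.
Proof. by rewrite divr_gt0 ?Rintegral_gw_gt0. Qed.

Lemma kap_neq0 : kap != 0.
Proof. by rewrite fmorph_eq0 gt_eqF // kapR_gt0. Qed.

Lemma gint1_kap : gint 0 1 = kap * gint b 1 :> C.
Proof.
rewrite !gint1 -rmorphM /= divfK // gt_eqF //; exact: Rintegral_gw_gt0.
Qed.

Lemma gint1_neq0 t : gint t (1 : {poly C}) != 0.
Proof. rewrite gint1 fmorph_eq0 gt_eqF //; exact: Rintegral_gw_gt0. Qed.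

Lemma lead_neq0 n :
  1 + (kap * a%:C ^+ 2 + c%:C ^+ 2) * n%:R / 2 != 0.
Proof.
have -> : 1 + (kap * a%:C ^+ 2 + c%:C ^+ 2) * n%:R / 2 =
  (1 + (kapR * a ^+ 2 + c ^+ 2) * n%:R / 2)%:C.
  by rewrite rmorphD rmorph1 !rmorphM /= rmorphD /= rmorphM /= !rmorphXn /= fmorphV !rmorph_nat.
rewrite fmorph_eq0 gt_eqF // ltr_pwDl //.
by rewrite !mulr_ge0 ?invr_ge0 ?ler0n // addr_ge0 ?sqr_ge0 // mulr_ge0 ?sqr_ge0 // ltW ?kapR_gt0.
Qed.

Definition oS n : MP := orthS a%:C b%:C c%:C kap n.

Let conj_coef n i j :
  Num.conj (model_coef a%:C c%:C kap n i j) = model_coef a%:C c%:C kap n i j.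
Proof.
elim/forall3: i; elim/forall3: j; rewrite mxE /= ?rmorph0 ?rmorph1 ?conj_realC //.
- by rewrite rmorphN !rmorphM /= !conj_realC fmorphV !rmorph_nat.
- by rewrite rmorphN !rmorphM /= !conj_realC fmorphV !rmorph_nat.
Qed.

Let gint_term t z w n m :
  Num.conj w = w ->
  gint t (hermT (z *: ('X - t%:C%:P) ^+ n) * conjp (hermT (w *: ('X - t%:C%:P) ^+ m)))
   = z * (w * (hnorm R n m * gint t 1)).
Proof.
move=> cw; rewrite !hermTZ -!/(hermY t _).
have -> : conjp (w *: hermY t m) = w *: hermY t m.
  by rewrite -mul_polyC /conjp rmorphM /= map_polyC /= cw -/(conjp _) conjp_hermY.
by rewrite -scalerAl -scalerAr !gintZ gint_hermY2.
Qed.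

Lemma inner_oS n m : inner (W a b c) (oS n) (oS m) =
  (hnorm R n m * gint b 1) *: gram a%:C c%:C kap n.
Proof.
apply/matrixP => i j; rewrite innerE /oS /orthS -!mulmxA unstraightK !mulmx1 [RHS]mxE.
rewrite -(@gramE _ _ _ _ (hnorm R)); last 2 first.
- exact: hnormS.
- by move=> n' m' /negPf nm; rewrite /hnorm nm mul0r.
rewrite /winner ![map_mx _ _ _ _]mxE -gint1_kap.
have [-> -> ->] := model_factor a%:C b%:C c%:C kap n i.
have [-> -> ->] := model_factor a%:C b%:C c%:C kap m j.
(* Powers of X are read as powers centred at 0, so that [gint_term] treats both Gaussians alike. *)
have X0 (k : nat) : 'X^k = ('X - (0%:C : C)%:P) ^+ k by rewrite rmorph0 subr0.
rewrite !X0.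
by rewrite (gint_term b) ?(gint_term 0) ?conj_coef.
Qed.

Lemma orthogonal_oS : orthogonal_seq (W a b c) oS.
Proof.
split=> [n|n m neq_nm]; last by rewrite inner_oS /hnorm (negPf neq_nm) !mul0r scale0r.
by split=> [i j|]; [exact: size_orthS|exact/lead_orthS/lead_neq0].
Qed.

Lemma inner_oS_unit n : inner (W a b c) (oS n) (oS n) \in unitmx.
Proof.
rewrite inner_oS unitmxZ; first by apply: gram_unit; [exact: kap_neq0|exact: lead_neq0..].
by rewrite unitfE mulf_neq0 ?gint1_neq0 // gt_eqF // hnorm_gt0.
Qed.

End OrthogonalSequence.

(** * Independence of the choice of orthogonal sequence *)

Section Characterization.
Local Open Scope complex_scope.
Local Open Scope sesquilinear_scope.
Variables (R : realType) (a b c : R).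
Local Notation C := R[i].
Local Notation inn := (inner (W a b c)).
Local Notation T := (oS a b c).

Let inner_suml k (G : nat -> 'M[C]_3) (S : nat -> 'M[{poly C}]_3) Q :
  inn (\sum_(j < k) map_mx polyC (G j) *m S j) Q = \sum_(j < k) G j *m inn (S j) Q.
Proof.
elim: k => [|k IH]; last by rewrite !big_ord_recr /= inner_addl IH inner_mull.
rewrite !big_ord0; have := inner_mull a b c 0 (0 : 'M[{poly C}]_3) Q.
by rewrite mulmx0 mul0mx.
Qed.

Let inner_sumr k (G : nat -> 'M[C]_3) (S : nat -> 'M[{poly C}]_3) P :
  (forall j, (j < k)%N -> inn P (S j) = 0) ->
  inn P (\sum_(j < k) map_mx polyC (G j) *m S j) = 0.
Proof.
elim: k => [|k IH] P0.
  rewrite !big_ord0; have := inner_mulr a b c 0 P (0 : 'M[{poly C}]_3).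
  by rewrite mulmx0 trmx0 map_mx0 mulmx0.
rewrite big_ord_recr /= inner_addr inner_mulr P0 // mul0mx addr0 IH // => j ltjk.
by rewrite P0 // ltnW.
Qed.

(** Expand [S k] in T 0, ..., T k. For l < k, T l is a combination of S 0, ..., S l and so is
    orthogonal to [S k]; pairing with T l then isolates the coefficient [G l], times an invertible
    Gram matrix. Only the term of index k survives. *)
Lemma orthogonal_seq_scale S k : orthogonal_seq (W a b c) S ->
  exists2 A : 'M[C]_3, A \in unitmx & S k = map_mx polyC A *m T k.
Proof.
case=> degS orthS; have [degT orthT] := orthogonal_oS a b c.
have [G SG] := mxdegree_span degT (degS k).1.
have S_T l : (l < k)%N -> inn (S k) (T l) = 0.
  move=> ltlk; have [G' ->] := mxdegree_span degS (degT l).1.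
  apply: inner_sumr => j ltjl; apply: orthS; rewrite gtn_eqF //.
  exact: leq_trans ltjl ltlk.
have G0 l : (l < k)%N -> G l = 0.
  move=> ltlk; have := S_T l ltlk; rewrite SG inner_suml.
  rewrite (bigD1 (Ordinal (ltnW ltlk : (l < k.+1)%N))) //= big1 ?addr0.
    move=> GT; have := mulmxK (inner_oS_unit a b c l) (G l).
    by rewrite GT mul0mx => <-.
  by move=> j neqj; rewrite orthT ?mulmx0.
have SGk : S k = map_mx polyC (G k) *m T k.
  rewrite SG big_ord_recr /= big1 ?add0r // => j _.
  by rewrite G0 // map_mx0 mul0mx.
exists (G k) => //; have := (degS k).2; rewrite SGk coefp_mull.
by rewrite unitmx_mul => /andP[].
Qed.

Lemma algD_orthS D : algD (W a b c) D <->
  forall n, exists G : 'M[C]_3, dact (T n) D = map_mx polyC G *m T n.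
Proof.
split=> [DW n|DT S orthS k]; first exact: DW (orthogonal_oS a b c) n.
have [A uA SA] := orthogonal_seq_scale k orthS; have [G TG] := DT k.
(* Changing the sequence by a left factor A conjugates the eigenvalue matrix by A. *)
exists (A *m G *m invmx A); rewrite SA dact_mull TG !mulmxA -!map_mxM.
by rewrite mulmxKV.
Qed.

Lemma D1_gD1 : D1 a b c = gD1 a%:C b%:C c%:C.
Proof. by rewrite /D1 /gD1 !rmorphM /= !rmorph_nat. Qed.

Lemma D2_gD2 : D2 a c = gD2 a%:C c%:C.
Proof.
by rewrite /D2 /gD2 !(rmorphD, rmorphM, fmorphV, rmorphXn, rmorph_nat).
Qed.

End Characterization.

Local Open Scope complex_scope.
Local Open Scope classical_set_scope.

Theorem theorem5p2 (R : realType) (a b c : R) :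
  a != 0 -> b != 0 -> c != 0 ->
  algD (W a b c) =
  [set D : diffop R[i] 2 | exists p q : {poly R[i]},
     D = horner_alg (D1 a b c) p * 1 + horner_alg (D1 a b c) q * D2 a c].
Proof.
move=> a0 b0 c0; have c0' : c%:C != 0 by rewrite fmorph_eq0.
rewrite D1_gD1 D2_gD2; apply/seteqP; split=> D.
  (* The eigenvalue matrices must form a sequence before polynomials in n can be extracted from
     them. *)
  move=> /algD_orthS /choice[G DG].
  by apply: (module_of_eigen c0' _ _ (kap_neq0 b) DG); rewrite fmorph_eq0.
case=> p [q ->]; apply/algD_orthS => n; eexists; exact: dact_orthS_module.
Qed.
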